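(* Let $k$ be any field, $V=\wedge^3k^6$, and let $G=\mathrm{GL}_6$ (acting by $\wedge^3$) or $G=\mathrm{GL}_1\times\mathrm{GL}_6$ (acting by $(t,g)x=t(\wedge^3g)x$). Let $V^{ss}=\{x\in V:x\neq0,\ 0\notin\overline{\mathrm{SL}_6\cdot x}\}$. Then $G(k)\backslash V^{ss}(k)$ is in bijective correspondence with $\mathrm{Ex}_2(k)$.
   Context: $\mathrm{Ex}_2(k)$ is the set of conjugacy classes of homomorphisms $\mathrm{Gal}(k^{\mathrm{sep}}/k)\to\mathfrak S_2$, equivalently the set of isomorphism classes of separable extensions of $k$ of degree at most $2$. *)

(* Defs.v *)
From HB Require Import structures.
From mathcomp Require Import all_boot all_order all_fingroup all_algebra all_field.
From mathcomp Require Import boolp classical_sets functions.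
From mathcomp Require Import mpoly.

Set Implicit Arguments.
Unset Strict Implicit.
Unset Printing Implicit Defensive.

Import GRing.Theory.
Local Open Scope ring_scope.

(* The standard basis e_{s 0} /\ ... /\ e_{s (r-1)} of the r-th exterior power
   of R^n is indexed by the increasing maps s : 'I_r -> 'I_n. *)
Definition incr (r n : nat) :=
  {s : {ffun 'I_r -> 'I_n} |
    [forall a : 'I_r, forall b : 'I_r, (a < b)%N ==> (s a < s b)%N]}.

Definition ext_dim (r n : nat) : nat := #|{: incr r n}|.

Definition ext_idx (r n : nat) (i : 'I_(ext_dim r n)) : 'I_r -> 'I_n :=
  val (enum_val i).

Notation extpow R r n := ('cV[R]_(ext_dim r n)).

(* u_0 /\ ... /\ u_(r-1), where u_a is the a-th column of U *)
Definition wedge (R : comNzRingType) (r n : nat) (U : 'M[R]_(n, r)) :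
    extpow R r n :=
  \col_i \det (rowsub (ext_idx i) U).

(* Matrix of the r-th exterior power of g acting on column vectors: the basis
   vector indexed by s is sent to (g e_{s 0}) /\ ... /\ (g e_{s (r-1)}). *)
Definition extmx (R : comNzRingType) (r n : nat) (g : 'M[R]_n) :
    'M[R]_(ext_dim r n) :=
  \matrix_(i, j) wedge (colsub (ext_idx j) g) i 0.

Section ExtmxWedge.
Variables (R : comNzRingType) (r n : nat).

Lemma incrP (s : incr r n) (a b : 'I_r) : (a < b)%N -> (val s a < val s b)%N.
Proof. by move=> ab; move/forallP/(_ a)/forallP/(_ b)/implyP/(_ ab): (valP s). Qed.

Lemma incr_mono (s : incr r n) (a b : 'I_r) :
  (val s a < val s b)%N = (a < b)%N.
Proof.
case: (ltngtP a b) => [/(incrP s) // | /(incrP s) ba | /val_inj ->].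
  by rewrite ltnNge (ltnW ba).
by rewrite ltnn.
Qed.

Lemma incr_perm_id (t : 'S_r) :
  (forall a b : 'I_r, (a < b)%N -> (t a < t b)%N) -> t = 1%g.
Proof.
have ge_id (u : 'S_r) : (forall a b : 'I_r, (a < b)%N -> (u a < u b)%N) ->
    forall m (hm : (m < r)%N), (m <= u (Ordinal hm))%N.
  move=> umono; elim=> [//|m IH] hm.
  have hm' := ltnW hm.
  apply: leq_ltn_trans (IH hm') _; exact: umono.
move=> tmono; apply/permP => a; rewrite perm1; apply/val_inj/eqP => /=.
rewrite eqn_leq andbC.
have -> /= : (a <= t a)%N by have := ge_id t tmono a (ltn_ord a); rewrite (_ : Ordinal _ = a) //; apply: val_inj.
have vmono (b c : 'I_r) : (b < c)%N -> (t^-1 b < t^-1 c)%g%N.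
  move=> bc; rewrite ltnNge; apply/negP; rewrite leq_eqVlt => /orP[/eqP/val_inj/perm_inj E|/tmono].
    by rewrite E ltnn in bc.
  by rewrite !permKV ltnNge (ltnW bc).
have := ge_id _ vmono (t a) (ltn_ord (t a)).
by rewrite (_ : Ordinal _ = t a) ?permK //; apply: val_inj.
Qed.

Let h (p : incr r n * 'S_r) : {ffun 'I_r -> 'I_n} := [ffun a => val p.1 (p.2 a)].

Let h_inj : injective h.
Proof.
move=> [s t] [s' t'] /ffunP /= E.
have E' a : val s ((t'^-1 * t)%g a) = val s' a.
  by have := E ((t'^-1)%g a); rewrite !ffunE /= permM permKV.
have tt' : (t'^-1 * t)%g = 1%g.
  by apply: incr_perm_id => a b; rewrite -(incr_mono s' a b) -!E' incr_mono.
have ss' : s = s'.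
  by apply/val_inj/ffunP => a; rewrite -E' tt' perm1.
by rewrite ss'; congr (_, _); apply/esym/(mulgI t'^-1%g); rewrite tt' mulVg.
Qed.

Let h_surj (f : {ffun 'I_r -> 'I_n}) : injective f -> exists p, f = h p.
Proof.
move=> finj.
pose rk (a : 'I_r) := #|[pred b : 'I_r | (f b < f a)%N]|.
have rk_lt a : (rk a < r)%N.
  rewrite -[X in (_ < X)%N](card_ord r) /rk; apply/proper_card/fintype.properP; split; first exact/fintype.subsetP.
  by exists a => //; rewrite inE ltnn.
have rk_mono (a b : 'I_r) : (f a < f b)%N -> (rk a < rk b)%N.
  move=> ab; apply/proper_card/fintype.properP; split.
    by apply/fintype.subsetP => c; rewrite !inE => ca; exact: ltn_trans ab.
  by exists a; rewrite !inE // ltnn.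
pose s (a : 'I_r) : 'I_r := Ordinal (rk_lt a).
have sinj : injective s.
  move=> a b /(congr1 val) /= E; case: (ltngtP (f a) (f b)) => [/rk_mono|/rk_mono|/val_inj/finj //].
    by rewrite E ltnn.
  by rewrite E ltnn.
pose t := perm sinj.
have mono (a b : 'I_r) : (a < b)%N -> (f (t^-1%g a) < f (t^-1%g b))%N.
  rewrite -{1}(permKV t a) -{1}(permKV t b) [t _]permE [t (_ b)]permE /= => ab.
  rewrite ltnNge leq_eqVlt; apply/negP => /orP[/eqP/val_inj E|/rk_mono].
    by rewrite /rk E ltnn in ab.
  by rewrite ltnNge (ltnW ab).
have Pg : [forall a : 'I_r, forall b : 'I_r, (a < b)%N ==>
   ([ffun a => f (t^-1%g a)] a < [ffun a => f (t^-1%g a)] b)%N].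
  by apply/forallP => a; apply/forallP => b; apply/implyP; rewrite !ffunE; exact: mono.
exists (Sub [ffun a => f (t^-1%g a)] Pg : incr r n, t); apply/ffunP => a.
by rewrite !ffunE /= ?ffunE permK.
Qed.

Lemma Cauchy_Binet (A : 'M[R]_(r, n)) (B : 'M[R]_(n, r)) :
  \det (A *m B) =
  \sum_(s : incr r n) \det (colsub (val s) A) * \det (rowsub (val s) B).
Proof.
transitivity (\sum_(f : {ffun 'I_r -> 'I_n})
                 (\prod_i A i (f i)) * \det (rowsub f B)).
  rewrite /determinant.
  under [RHS]eq_bigr => f _ do rewrite big_distrr /=.
  rewrite exchange_big; apply: eq_bigr => /= s _.
  under [RHS]eq_bigr => f _ do rewrite mulrCA.
  rewrite -big_distrr /=; congr (_ * _).
  under [RHS]eq_bigr => f _ do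
    (rewrite -big_split /=; under eq_bigr => i _ do rewrite mxE).
  rewrite -(bigA_distr_bigA (fun i j => A i j * B j (s i))) /=.
  by apply: eq_bigr => i _; rewrite mxE.
rewrite (bigID (fun f : {ffun 'I_r -> 'I_n} => injectiveb f)) /= addrC big1 ?add0r; last first.
  move=> f /injectivePn[i1 [i2 Di12 Ef12]].
  by rewrite (determinant_alternate Di12) ?mulr0 // => j; rewrite !mxE Ef12.
rewrite (eq_bigl (mem [set h p | p in [set: incr r n * 'S_r]%SET]%SET)); last first.
  move=> f; apply/injectiveP/imsetP => [/h_surj[p ->]|[[s t] _ -> a b]]; first by exists p.
  rewrite !ffunE /= => E; apply: (@perm_inj _ t); apply: val_inj.
  by case: (ltngtP (t a) (t b)) => //; rewrite -(incr_mono s) E ltnn.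
rewrite big_imset /=; last by move=> ? ? _ _; exact: h_inj.
rewrite (eq_bigl xpredT) => [|p]; last by rewrite inE.
rewrite -(pair_bigA _ (fun s t => (\prod_i A i (h (s, t) i)) * \det (rowsub (h (s, t)) B))) /=.
apply: eq_bigr => s _; rewrite [X in _ = X * _]/determinant big_distrl /=.
apply: eq_bigr => t _.
have -> : rowsub (h (s, t)) B = perm_mx t *m rowsub (val s) B.
  by rewrite -row_permE; apply/matrixP => i j; rewrite !mxE ffunE.
rewrite det_mulmx det_perm mulrA; congr (_ * _).
by rewrite mulrC; congr (_ * _); apply: eq_bigr => i _; rewrite !mxE ffunE.
Qed.

Lemma extmx_wedge (g : 'M[R]_n) (U : 'M[R]_(n, r)) :
  extmx r g *m wedge U = wedge (g *m U).
Proof.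
apply/matrixP => i j; rewrite !mxE.
have -> : rowsub (ext_idx i) (g *m U) = rowsub (ext_idx i) g *m U.
  by apply/matrixP => a b; rewrite !mxE; apply: eq_bigr => c _; rewrite !mxE.
rewrite Cauchy_Binet (reindex_onto (@enum_val _ (mem {: incr r n})) enum_rank) /=; last first.
  by move=> s _; rewrite enum_rankK.
apply: eq_big => [c|c _]; first by rewrite enum_valK eqxx.
rewrite !mxE; congr (\det _ * _).
by apply/matrixP => a b; rewrite !mxE.
Qed.

End ExtmxWedge.

Local Open Scope classical_set_scope.

Definition zariski_closed (K : fieldType) (n : nat) (Z : set 'cV[K]_n) : Prop :=
  exists P : set {mpoly K[n]},
    Z = [set x | forall p, P p -> p.@[fun i => x i 0] = 0].

Definition zariski_closure (K : fieldType) (n : nat) (A : set 'cV[K]_n) :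
  set 'cV[K]_n := smallest (@zariski_closed K n) A.

Definition SL_orbit (K : fieldType) (x : extpow K 3 6) :
    set (extpow K 3 6) :=
  [set extmx 3 g *m x | g in [set g : 'M[K]_6 | \det g = 1]].

Definition is_algebraic_closure (k : fieldType) (K : closedFieldType)
    (iota : {rmorphism k -> K}) : Prop :=
  forall a : K, algebraicOver iota a.

(* The k-rational points of V^ss; the closure is taken geometrically, that is,
   for the points over the algebraic closure K of k. *)
Definition Vss (k : fieldType) (K : closedFieldType) (iota : {rmorphism k -> K}) :
    set (extpow k 3 6) :=
  [set x | map_mx iota x != 0 /\
           ~ zariski_closure (SL_orbit (map_mx iota x)) 0].

Definition GL_orbit (k : fieldType) (x : extpow k 3 6) :
    set (extpow k 3 6) :=
  [set y | exists2 g : 'M[k]_6, g \in unitmx & y = extmx 3 g *m x].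

Definition GL1GL_orbit (k : fieldType) (x : extpow k 3 6) :
    set (extpow k 3 6) :=
  [set y | exists (t : k) (g : 'M[k]_6),
     [/\ t != 0, g \in unitmx & y = t *: (extmx 3 g *m x)]].

Definition ext_isom (k : fieldType) (L M : fieldExtType k) : Prop :=
  exists f : {lrmorphism L -> M}, bijective f.

(* The isomorphism classes are plain predicates on extensions, and [bij_on]
   replaces [set_bij]: the universe of [fieldExtType k] is too large for [set]. *)
Definition Ex2 (k : fieldType) (C : fieldExtType k -> Prop) : Prop :=
  exists L : fieldExtType k,
    [/\ separable 1%VS {:L}%VS, (\dim {:L} <= 2)%N & C = ext_isom L].

Definition bij_on (A B : Type) (P : A -> Prop) (Q : B -> Prop) (f : A -> B) :
    Prop :=
  [/\ forall a, P a -> Q (f a),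
      forall a a', P a -> P a' -> f a = f a' -> a = a' &
      forall b, Q b -> exists2 a, P a & f a = b].

(* Main.v *)
From HB Require Import structures.
Require Import Defs.
From mathcomp Require Import all_boot all_order all_fingroup all_algebra all_field.
From mathcomp Require Import boolp classical_sets functions.
From mathcomp Require Import mpoly ring zify.

(** A trivector x is read as an alternating trilinear form f on row vectors, so
    that the coordinates of g x are the values of f on the rows of g.

    Suppose that f (v, -, -) has rank 4 for some v. Then x = e /\ w + e' /\ w'
    with w, w' bivectors of a 4-space, w nondegenerate, and if w' is not a
    multiple of w a suitable basis turns f into tau \o det on A^3, where
    A = k[T]/(T^2 - a T + b) and tau is the linear form with tau 1 = 0 and
    tau T = 1. In all other cases, and also when a^2 = 4 b (after passing to the
    algebraic closure), there is a 3-space N with f (N, N, -) = 0, and a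
    one-parameter subgroup contracts x to 0.

    Conversely, if a^2 <> 4 b, then over the closure x becomes a sum of two
    decomposable trivectors u1 /\ u2 /\ u3 + u4 /\ u5 /\ u6 with (u_i) a basis.
    On such sums the covariant v |-> (contraction of x by v) /\ x is a
    multiple of an involution, and its determinant is an invariant polynomial
    which does not vanish on the orbit but vanishes at 0, in any characteristic.

    Finally T^2 - a T + b has a root in an extension M of k if and only if
    f (v, -, -) has rank at most 2 for some nonzero v in M^6. Hence the orbit
    determines which M receive the quadratic algebra A, and so A itself;
    isomorphic algebras give equivalent forms by a linear substitution of T. *)

Set Implicit Arguments.
Unset Strict Implicit.
Unset Printing Implicit Defensive.

Import GRing.Theory.
Local Open Scope ring_scope.

(** * Alternating forms *)

Section AltForm.
Variables (R : comNzRingType) (r n : nat).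
Implicit Types (x : extpow R r n) (M : 'M[R]_(r, n)) (g h : 'M[R]_n).

(** The pairing of [x] with the wedge of the rows of [M]: maximal minors of [M] against coordinates
    of [x]. *)
Definition altform x M := \sum_i \det (colsub (ext_idx i) M) * x i 0.

Lemma sum_ext_idx (F : ('I_r -> 'I_n) -> R) :
  \sum_(s : incr r n) F (val s) = \sum_i F (@ext_idx r n i).
Proof.
rewrite (reindex_onto (@enum_val _ (mem {: incr r n})) enum_rank) /=; last first.
  by move=> s _; rewrite enum_rankK.
by apply: eq_bigl => c; rewrite enum_valK eqxx.
Qed.

Lemma altform_wedge (U : 'M[R]_(n, r)) M : altform (wedge U) M = \det (M *m U).
Proof.
rewrite Cauchy_Binet (sum_ext_idx (fun s => \det (colsub s M) * \det (rowsub s U))).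
by apply: eq_bigr => i _; rewrite mxE.
Qed.

(** The columns of [extmx r g] are wedges, so [altform_wedge], that is Cauchy-Binet, applies to each
    of them. *)
Lemma altform_extmx g x M : altform (extmx r g *m x) M = altform x (M *m g).
Proof.
rewrite /altform; under eq_bigr => i _ do rewrite mxE big_distrr /=.
rewrite exchange_big /=; apply: eq_bigr => j _.
under eq_bigr => i _ do rewrite mulrA mxE.
rewrite -big_distrl /=; congr (_ * _).
have -> : colsub (ext_idx j) (M *m g) = M *m colsub (ext_idx j) g.
  by apply/matrixP => a b; rewrite !mxE; apply: eq_bigr => c _; rewrite !mxE.
exact: altform_wedge.
Qed.

Lemma altform_mulmx (C : 'M[R]_r) x M : altform x (C *m M) = \det C * altform x M.
Proof.
rewrite /altform big_distrr /=; apply: eq_bigr => i _; rewrite mulrA -det_mulmx.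
congr (\det _ * _).
by apply/matrixP => a b; rewrite !mxE; apply: eq_bigr => c _; rewrite !mxE.
Qed.

Lemma ext_idx_mono (i : 'I_(ext_dim r n)) (a b : 'I_r) :
  (ext_idx i a < ext_idx i b)%N = (a < b)%N.
Proof. exact: incr_mono. Qed.

Lemma ext_idx_inj (i : 'I_(ext_dim r n)) : injective (ext_idx i).
Proof.
move=> a b E; apply: val_inj.
by case: (ltngtP a b) => //; rewrite -(ext_idx_mono i) E ltnn.
Qed.

(** A nonzero Leibniz term yields a permutation turning one index map into the other; since both are
    increasing, it is the identity. Hence the coordinates of [x] are values of its form. *)
Lemma det_ext_idx1 (i j : 'I_(ext_dim r n)) :
  \det (colsub (ext_idx j) (rowsub (ext_idx i) 1%:M)) = (i == j)%:R :> R.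
Proof.
have [<-|ij] := eqVneq i j.
  rewrite -[RHS](det1 R r); congr (\det _); apply/matrixP => a b.
  by rewrite !mxE (inj_eq (@ext_idx_inj i)).
rewrite /determinant big1 // => t _.
suff [a] : exists a, ext_idx i a != ext_idx j (t a).
  by move=> H; rewrite (bigD1 a) //= !mxE (negPf H) mul0r mulr0.
apply/existsP; apply: contraNT ij => /existsPn E.
have {}E a : ext_idx i a = ext_idx j (t a) by apply/eqP/negPn/E.
have t1 : t = 1%g.
  by apply: incr_perm_id => a b ab; rewrite -(ext_idx_mono j) -!E ext_idx_mono.
apply/eqP/enum_val_inj/val_inj/ffunP => a.
by have := E a; rewrite t1 perm1.
Qed.

Lemma altform_idx x i : altform x (rowsub (ext_idx i) 1%:M) = x i 0.
Proof.
rewrite /altform (bigD1 i) //= det_ext_idx1 eqxx mul1r big1 ?addr0 // => j ji.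
by rewrite det_ext_idx1 eq_sym (negPf ji) mul0r.
Qed.

Lemma mul_rowsub (s : 'I_r -> 'I_n) g h : rowsub s g *m h = rowsub s (g *m h).
Proof. by apply/matrixP => a b; rewrite !mxE; apply: eq_bigr => c _; rewrite !mxE. Qed.

Lemma extmxE g x i : (extmx r g *m x) i 0 = altform x (rowsub (ext_idx i) g).
Proof. by rewrite -altform_idx altform_extmx mul_rowsub mul1mx. Qed.

Lemma extmxM g h x : extmx r (g *m h) *m x = extmx r g *m (extmx r h *m x).
Proof.
by apply/colP => i; rewrite !extmxE altform_extmx mul_rowsub.
Qed.

Lemma extmx1 x : extmx r 1%:M *m x = x.
Proof. by apply/colP => i; rewrite extmxE altform_idx. Qed.

Lemma altformD x y M : altform (x + y) M = altform x M + altform y M.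
Proof. by rewrite -big_split; apply: eq_bigr => i _; rewrite mxE mulrDr. Qed.

Lemma altformZ t x M : altform (t *: x) M = t * altform x M.
Proof. by rewrite /altform big_distrr; apply: eq_bigr => i _; rewrite mxE /= mulrCA. Qed.

End AltForm.

Lemma altform_map (R S : comNzRingType) (f : {rmorphism R -> S}) r n
    (x : extpow R r n) (M : 'M[R]_(r, n)) :
  altform (map_mx f x) (map_mx f M) = f (altform x M).
Proof.
rewrite rmorph_sum; apply: eq_bigr => i _.
by rewrite rmorphM mxE -det_map_mx; congr (\det _ * _); apply/matrixP => a b; rewrite !mxE.
Qed.

Lemma extmx_map (R S : comNzRingType) (f : {rmorphism R -> S}) r n
    (g : 'M[R]_n) (x : extpow R r n) :
  map_mx f (extmx r g *m x) = extmx r (map_mx f g) *m map_mx f x.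
Proof.
apply/colP => i; rewrite extmxE mxE extmxE -altform_map.
by congr altform; apply/matrixP => a b; rewrite !mxE.
Qed.

(** * Trilinear forms on row vectors *)

Section TriForm.
Variable R : comNzRingType.
Implicit Types (x : extpow R 3 6) (u v w : 'rV[R]_6).

Definition row3 u v w : 'M[R]_(3, 6) := \matrix_(i < 3) [:: u; v; w]`_i.

Definition tri x u v w := altform x (row3 u v w).

Lemma det_mx33 (A : 'M[R]_3) (i0 := 0) (i1 := lift 0 0) (i2 := lift 0 (lift 0 0)) :
  \det A = A i0 i0 * (A i1 i1 * A i2 i2 - A i1 i2 * A i2 i1)
         - A i0 i1 * (A i1 i0 * A i2 i2 - A i1 i2 * A i2 i0)
         + A i0 i2 * (A i1 i0 * A i2 i1 - A i1 i1 * A i2 i0).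
Proof.
(* Indexing the entries by naturals makes equal the different terms that cofactor expansion produces
   for one ordinal, so that [ring] can identify them. *)
pose a (i j : nat) := A (inord i) (inord j).
have E i j : A i j = a i j by rewrite /a !inord_val.
rewrite (expand_det_row _ 0) !big_ord_recl big_ord0 /cofactor.
rewrite !(expand_det_row _ 0) !big_ord_recl !big_ord0 /cofactor !det_mx11 !mxE.
rewrite !E /= /bump /= !add0n ?add1n ?addn0 /= !expr0 !expr1 ?sqrrN ?expr1n; ring.
Qed.

Lemma triE x u v w : tri x u v w = \sum_i x i 0 *
  (let p := ext_idx i 0 in let q := ext_idx i (lift 0 0) in
   let r := ext_idx i (lift 0 (lift 0 0)) in
   u 0 p * (v 0 q * w 0 r - v 0 r * w 0 q)
 - u 0 q * (v 0 p * w 0 r - v 0 r * w 0 p)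
 + u 0 r * (v 0 p * w 0 q - v 0 q * w 0 p)).
Proof.
apply: eq_bigr => i _; rewrite mulrC; congr (_ * _).
by rewrite det_mx33 !mxE /=.
Qed.

Lemma tri_linear x c u u' v w :
  tri x (c *: u + u') v w = c * tri x u v w + tri x u' v w.
Proof.
rewrite !triE big_distrr -big_split; apply: eq_bigr => i _ /=.
rewrite !mxE; ring.
Qed.

Lemma tri_rot x u v w : tri x u v w = tri x v w u.
Proof. by rewrite !triE; apply: eq_bigr => i _ /=; ring. Qed.

Lemma triC12 x u v w : tri x v u w = - tri x u v w.
Proof. by rewrite !triE -sumrN; apply: eq_bigr => i _ /=; ring. Qed.

Lemma tri_alt x u w : tri x u u w = 0.
Proof. by rewrite !triE big1 // => i _ /=; ring. Qed.

Lemma altform_tri x (M : 'M[R]_(3, 6)) :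
  altform x M = tri x (row 0 M) (row (lift 0 0) M) (row (lift 0 (lift 0 0)) M).
Proof.
congr altform; apply/matrixP => i j; rewrite mxE.
by case: i => [[|[|[|//]]] H]; rewrite /= !mxE; congr (M _ _); apply: val_inj.
Qed.

Lemma tri_extmx x g u v w :
  tri (extmx 3 g *m x) u v w = tri x (u *m g) (v *m g) (w *m g).
Proof.
rewrite /tri altform_extmx; congr altform; apply/row_matrixP => i.
rewrite row_mul !rowK.
by case: i => [[|[|[|//]]] H].
Qed.

Lemma extmx_tri x g i :
  (extmx 3 g *m x) i 0 = tri x (row (ext_idx i 0) g)
    (row (ext_idx i (lift 0 0)) g) (row (ext_idx i (lift 0 (lift 0 0))) g).
Proof.
by rewrite extmxE altform_tri; congr tri; apply/rowP => j; rewrite !mxE.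
Qed.

Lemma coord_tri x i :
  x i 0 = tri x (delta_mx 0 (ext_idx i 0)) (delta_mx 0 (ext_idx i (lift 0 0)))
            (delta_mx 0 (ext_idx i (lift 0 (lift 0 0)))).
Proof. by rewrite -{1}(extmx1 x) extmx_tri !rowE !mulmx1. Qed.

End TriForm.

Lemma tri_map (R S : comNzRingType) (f : {rmorphism R -> S}) (x : extpow R 3 6) u v w :
  tri (map_mx f x) (map_mx f u) (map_mx f v) (map_mx f w) = f (tri x u v w).
Proof.
rewrite -altform_map; congr altform; apply/matrixP => i j; rewrite !mxE.
by case: i => [[|[|[|//]]] H] /=; rewrite !mxE.
Qed.

Section TriTheory.
Variable R : comNzRingType.
Implicit Types (x : extpow R 3 6) (u v w : 'rV[R]_6).

Lemma triDl x u u' v w : tri x (u + u') v w = tri x u v w + tri x u' v w.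
Proof. by rewrite -[u]scale1r tri_linear mul1r scale1r. Qed.

Lemma tri0l x v w : tri x 0 v w = 0.
Proof. by apply: (addrI (tri x 0 v w)); rewrite -triDl !addr0. Qed.

Lemma triZl x c u v w : tri x (c *: u) v w = c * tri x u v w.
Proof. by rewrite -[c *: u]addr0 tri_linear tri0l addr0. Qed.

Lemma triDm x u v v' w : tri x u (v + v') w = tri x u v w + tri x u v' w.
Proof. by rewrite 3!(tri_rot x u) triDl. Qed.

Lemma triZm x c u v w : tri x u (c *: v) w = c * tri x u v w.
Proof. by rewrite 2!(tri_rot x u) triZl. Qed.

Lemma triDr x u v w w' : tri x u v (w + w') = tri x u v w + tri x u v w'.
Proof. by rewrite -3!(tri_rot x _ u v) triDl. Qed.

Lemma triZr x c u v w : tri x u v (c *: w) = c * tri x u v w.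
Proof. by rewrite -2!(tri_rot x _ u v) triZl. Qed.

Lemma triC23 x u v w : tri x u w v = - tri x u v w.
Proof. by rewrite -tri_rot triC12 tri_rot. Qed.

Lemma tri_alt23 x u v : tri x u v v = 0.
Proof. by rewrite tri_rot tri_alt. Qed.

Lemma tri_alt13 x u v : tri x u v u = 0.
Proof. by rewrite -tri_rot tri_alt. Qed.

Definition triL := (triDl, triZl, triDm, triZm, triDr, triZr,
  tri_alt, tri_alt23, tri_alt13).

Definition rows6 (v0 v1 v2 v3 v4 v5 : 'rV[R]_6) : 'M[R]_6 :=
  \matrix_(i < 6) [:: v0; v1; v2; v3; v4; v5]`_i.

Lemma mul_rows6 (z : 'rV[R]_6) v0 v1 v2 v3 v4 v5 :
  z *m rows6 v0 v1 v2 v3 v4 v5 =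
  z 0 (inord 0) *: v0 + z 0 (inord 1) *: v1 + z 0 (inord 2) *: v2 +
  z 0 (inord 3) *: v3 + z 0 (inord 4) *: v4 + z 0 (inord 5) *: v5.
Proof.
rewrite mulmx_sum_row !big_ord_recl big_ord0 !rowK /= addr0 !addrA.
by do !congr (_ + _); congr (z 0 _ *: _); apply: val_inj; rewrite /= inordK.
Qed.

End TriTheory.

(** * Bases and linear forms in dimension 6 *)

Section Rows6.
Variable F : fieldType.
Implicit Types (u v w : 'rV[F]_6).

Lemma rows6_unit v0 v1 v2 v3 v4 v5 :
  (forall z0 z1 z2 z3 z4 z5 : F,
     z0 *: v0 + z1 *: v1 + z2 *: v2 + z3 *: v3 + z4 *: v4 + z5 *: v5 = 0 ->
     [/\ z0 = 0, z1 = 0 & z2 = 0] /\ [/\ z3 = 0, z4 = 0 & z5 = 0]) ->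
  rows6 v0 v1 v2 v3 v4 v5 \in unitmx.
Proof.
move=> H; rewrite -row_free_unit; apply: inj_row_free => z.
rewrite mul_rows6 => /H[[z0 z1 z2] [z3 z4 z5]].
apply/rowP => i; rewrite mxE -(inord_val i).
by case: i => [[|[|[|[|[|[|//]]]]]] Hi].
Qed.

Lemma rows6_span v0 v1 v2 v3 v4 v5 w : rows6 v0 v1 v2 v3 v4 v5 \in unitmx ->
  exists z0 z1 z2 z3 z4 z5 : F,
  w = z0 *: v0 + z1 *: v1 + z2 *: v2 + z3 *: v3 + z4 *: v4 + z5 *: v5.
Proof.
move=> gU; rewrite -{1}(mulmxKV gU w) mul_rows6.
by do 6!eexists.
Qed.

(** Fewer than six linear forms give a matrix of rank below 6, whose left kernel is nonzero. The
    zero form as default value lets a single hypothesis express linearity of the whole list. *)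
Lemma common_zero (l : seq ('rV[F]_6 -> F)) :
  (size l < 6)%N ->
  (forall i c u u', nth (fun=> 0) l i (c *: u + u') =
     c * nth (fun=> 0) l i u + nth (fun=> 0) l i u') ->
  exists2 w, w != 0 & forall i, nth (fun=> 0) l i w = 0.
Proof.
move=> sz lin.
pose A : 'M[F]_(6, size l) := \matrix_(i, j) nth (fun=> 0) l j (delta_mx 0 i).
have : kermx A != 0.
  rewrite kermx_eq0 /row_free neq_ltn; apply/orP; left.
  exact: leq_ltn_trans (rank_leq_col A) _.
move=> /rowV0Pn[w /sub_kermxP wA w0]; exists w => // i.
have lin0 : nth (fun=> 0) l i 0 = 0.
  have := lin i 1 0 0; rewrite scale1r addr0 mul1r => E.
  by apply: (addrI (nth (fun=> 0) l i 0)); rewrite -E addr0.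
have [si|si] := leqP (size l) i; first by rewrite nth_default.
have := congr1 (fun B : 'rV_(size l) => B 0 (Ordinal si)) wA; rewrite mxE [RHS]mxE => E.
rewrite -[RHS]E {1}(row_sum_delta w); elim: (index_enum _) => [|j s IH].
  by rewrite !big_nil lin0.
by rewrite !big_cons lin IH mxE.
Qed.

End Rows6.

(** * The normal forms *)

Definition o6 (i : nat) : 'I_6 := inord i.

Section NormalForm.
Variable R : comNzRingType.
Implicit Types (a b : R) (u v w : 'rV[R]_6).

Definition ewedge (p q r : nat) : extpow R 3 6 :=
  wedge (\matrix_(i < 6, j < 3) (i == nth 0%N [:: p; q; r] j :> nat)%:R).

Definition det_at u v w (p q r : nat) : R :=
  u 0 (o6 p) * (v 0 (o6 q) * w 0 (o6 r) - v 0 (o6 r) * w 0 (o6 q))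
  - u 0 (o6 q) * (v 0 (o6 p) * w 0 (o6 r) - v 0 (o6 r) * w 0 (o6 p))
  + u 0 (o6 r) * (v 0 (o6 p) * w 0 (o6 q) - v 0 (o6 q) * w 0 (o6 p)).

Lemma tri_ewedge u v w p q r : (p < 6)%N -> (q < 6)%N -> (r < 6)%N ->
  tri (ewedge p q r) u v w = det_at u v w p q r.
Proof.
move=> p6 q6 r6; rewrite /tri altform_wedge det_mx33.
have E (y : 'rV[R]_6) m : (m < 6)%N -> \sum_(j < 6) y 0 j * (j == m :> nat)%:R = y 0 (o6 m).
  move=> m6; rewrite (bigD1 (o6 m)) //= inordK // eqxx mulr1 big1 ?addr0 // => j.
  by rewrite -val_eqE /= inordK // => /negPf ->; rewrite mulr0.
have E2 (i j : 'I_3) (y : 'rV[R]_6) m : (row3 u v w) i = y 0 ->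
  nth 0%N [:: p; q; r] j = m -> (m < 6)%N ->
  (row3 u v w *m \matrix_(i < 6, j < 3) (i == nth 0%N [:: p; q; r] j :> nat)%:R) i j = y 0 (o6 m).
  move=> Ey <- m6; rewrite mxE -E //; apply: eq_bigr => l _.
  by rewrite Ey [X in _ * X]mxE.
have R0 : row3 u v w 0 = u 0 by apply/funext => j; rewrite !mxE.
have R1 : row3 u v w (lift 0 0) = v 0 by apply/funext => j; rewrite !mxE.
have R2 : row3 u v w (lift 0 (lift 0 0)) = w 0 by apply/funext => j; rewrite !mxE.
by rewrite !(E2 _ _ _ _ R0 erefl) ?(E2 _ _ _ _ R1 erefl) ?(E2 _ _ _ _ R2 erefl).
Qed.

(* As a trilinear form this is [tau \o \det] on [A^3], where [A] is
   [R['T]/('T^2 - a 'T + b)] and [tau] is the linear form on [A] with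
   [tau 1 = 0] and [tau 'T = 1], so that [tau ('T^2) = a] and
   [tau ('T^3) = a ^+ 2 - b]; the basis of [A^3] is [(1, 'T)] in each copy. *)
Definition nf a b : extpow R 3 6 :=
  ewedge 0 2 5 + ewedge 0 3 4 + ewedge 1 2 4 +
  a *: (ewedge 0 3 5 + ewedge 1 2 5 + ewedge 1 3 4) +
  (a ^+ 2 - b) *: ewedge 1 3 5.

Lemma tri_nf a b u v w (d := det_at u v w) : tri (nf a b) u v w =
  d 0 2 5 + d 0 3 4 + d 1 2 4 + a * (d 0 3 5 + d 1 2 5 + d 1 3 4) +
  (a ^+ 2 - b) * d 1 3 5.
Proof. by rewrite /tri !(altformD, altformZ) -!/(tri _ _ _ _) !tri_ewedge. Qed.

(** In terms of [A^3], [p./2] is the copy containing the basis vector [p] and [odd p] its exponent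
    of [T]. The list holds [tau (T^e)] for [e] from 0 to 3. *)
Definition nf_coef a b (p q r : nat) : R :=
  if [&& p./2 == 0, q./2 == 1 & r./2 == 2]%N
  then [:: 0; 1; a; a ^+ 2 - b]`_(odd p + odd q + odd r) else 0.

Lemma nfE a b i : nf a b i 0 =
  nf_coef a b (ext_idx i 0) (ext_idx i (lift 0 0)) (ext_idx i (lift 0 (lift 0 0))).
Proof.
rewrite coord_tri tri_nf /det_at.
have := ext_idx_mono i 0 (lift 0 0); have := ext_idx_mono i (lift 0 0) (lift 0 (lift 0 0)).
move: (ext_idx i 0) (ext_idx i (lift 0 0)) (ext_idx i (lift 0 (lift 0 0))) => p q r.
rewrite /= /o6 /bump /= => lt_qr lt_pq; rewrite !mxE !eqxx -!val_eqE /= !inordK //.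
by case: p q r lt_pq lt_qr => [[|[|[|[|[|[|//]]]]]] Hp] [[|[|[|[|[|[|//]]]]]] Hq]
  [[|[|[|[|[|[|//]]]]]] Hr] //= _ _; rewrite /nf_coef /=; ring.
Qed.

Lemma extmx_nf x g a b :
  (forall p q r : 'I_6, (p < q)%N -> (q < r)%N ->
     tri x (row p g) (row q g) (row r g) = nf_coef a b p q r) ->
  extmx 3 g *m x = nf a b.
Proof.
by move=> H; apply/colP => i; rewrite extmx_tri nfE H // ext_idx_mono.
Qed.

Lemma tri_nf_delta a b u (i j : nat) : (i < 6)%N -> (j < 6)%N ->
  tri (nf a b) u (delta_mx 0 (o6 i)) (delta_mx 0 (o6 j)) =
  let d p q r :=
    u 0 (o6 p) * ((q == i)%:R * (r == j)%:R - (r == i)%:R * (q == j)%:R)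
    - u 0 (o6 q) * ((p == i)%:R * (r == j)%:R - (r == i)%:R * (p == j)%:R)
    + u 0 (o6 r) * ((p == i)%:R * (q == j)%:R - (q == i)%:R * (p == j)%:R) in
  d 0 2 5 + d 0 3 4 + d 1 2 4 + a * (d 0 3 5 + d 1 2 5 + d 1 3 4) +
  (a ^+ 2 - b) * d 1 3 5.
Proof. by move=> i6 j6; rewrite tri_nf /det_at !mxE !eqxx -!val_eqE /= !inordK. Qed.

(** Each coordinate of [u] is isolated by evaluating at a suitable pair of basis vectors; the order
    matters, since some evaluations involve a coordinate already known to vanish. *)
Lemma nf_nondeg a b u : (forall v w, tri (nf a b) u v w = 0) -> u = 0.
Proof.
move=> H; have E i j := H (delta_mx 0 (o6 i)) (delta_mx 0 (o6 j)).
have u1 : u 0 (o6 1) = 0 by have := E 2 4; rewrite tri_nf_delta //= => <-; ring.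
have u0 : u 0 (o6 0) = 0 by have := E 2 5; rewrite tri_nf_delta //= u1 => <-; ring.
have u3 : u 0 (o6 3) = 0 by have := E 4 0%N; rewrite tri_nf_delta //= => <-; ring.
have u2 : u 0 (o6 2) = 0 by have := E 5 0%N; rewrite tri_nf_delta //= u3 => <-; ring.
have u5 : u 0 (o6 5) = 0 by have := E 0%N 2; rewrite tri_nf_delta //= => <-; ring.
have u4 : u 0 (o6 4) = 0 by have := E 0%N 3; rewrite tri_nf_delta //= u5 => <-; ring.
apply/rowP => i; rewrite mxE -(inord_val i).
by case: i => [[|[|[|[|[|[|//]]]]]] Hi].
Qed.

End NormalForm.

Lemma nf_map (R S : comNzRingType) (f : {rmorphism R -> S}) (a b : R) :
  map_mx f (nf a b) = nf (f a) (f b).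
Proof.
apply/colP => i; rewrite mxE !nfE /nf_coef; case: ifP => _; last by rewrite rmorph0.
by case: (odd _) (odd _) (odd _) => [] [] [] /=; rewrite ?rmorphB ?rmorphXn ?rmorph0 ?rmorph1.
Qed.

(** A row vector killed by [g] lies in the radical of the transformed form, which is zero.
    Invertibility thus never has to be checked separately. *)
Lemma nf_unit (F : fieldType) (x : extpow F 3 6) g a b :
  extmx 3 g *m x = nf a b -> g \in unitmx.
Proof.
move=> E; rewrite -row_free_unit; apply: inj_row_free => z zg.
by apply: (@nf_nondeg _ a b) => v w; rewrite -E tri_extmx zg tri0l.
Qed.

Lemma nf_orbit (F : fieldType) (x : extpow F 3 6) g a b :
  (forall p q r : 'I_6, (p < q)%N -> (q < r)%N ->
     tri x (row p g) (row q g) (row r g) = nf_coef a b p q r) ->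
  GL_orbit x (nf a b).
Proof.
by move=> /extmx_nf E; exists g; [exact: nf_unit E|].
Qed.

(** * Reduction to normal form *)

(** The last three rows of [g] span the 3-space [N] with [f (N, N, -) = 0]; completing them to a
    basis is what the contracting one-parameter group requires. *)
Definition null3 (F : fieldType) (x : extpow F 3 6) : Prop :=
  exists2 g : 'M[F]_6, g \in unitmx & forall i j l : 'I_6,
    (3 <= i)%N -> (3 <= j)%N -> tri x (row i g) (row j g) (row l g) = 0.

Lemma null3_map (F E : fieldType) (f : {rmorphism F -> E}) (x : extpow F 3 6) :
  null3 x -> null3 (map_mx f x).
Proof.
case=> g gU H; exists (map_mx f g); first by rewrite map_unitmx.
by move=> i j l i3 j3; rewrite -!map_row tri_map H // rmorph0.
Qed.

Lemma null3_extmx (F : fieldType) (x : extpow F 3 6) h :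
  h \in unitmx -> null3 (extmx 3 h *m x) -> null3 x.
Proof.
move=> hU [g gU H]; exists (g *m h); first by rewrite unitmx_mul gU.
by move=> i j l i3 j3; rewrite !row_mul -tri_extmx H.
Qed.

Section Classification.
Variables (F : fieldType) (x : extpow F 3 6).
Implicit Types (u v w n : 'rV[F]_6).
Local Notation f := (tri x).

Lemma null3_rows v0 v1 v2 n1 n2 n3 : rows6 v0 v1 v2 n1 n2 n3 \in unitmx ->
  (forall w, f n1 n2 w = 0) -> (forall w, f n1 n3 w = 0) -> (forall w, f n2 n3 w = 0) ->
  null3 x.
Proof.
move=> gU H12 H13 H23; exists (rows6 v0 v1 v2 n1 n2 n3) => // i j l i3 j3.
move: (row l _) => w; rewrite !rowK.
case: i i3 => [[|[|[|[|[|[|//]]]]]] Hi] //= _;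
case: j j3 => [[|[|[|[|[|[|//]]]]]] Hj] //= _; rewrite ?tri_alt ?H12 ?H13 ?H23 //;
  by rewrite triC12 ?H12 ?H13 ?H23 oppr0.
Qed.

(** Every alternating form [f p] has rank at most 2: the orthogonal of a hyperbolic pair [a], [b] is
    totally isotropic. *)
Definition no_rank4 := forall p a b c d, f p a b = 1 ->
  f p a c = 0 -> f p b c = 0 -> f p a d = 0 -> f p b d = 0 -> f p c d = 0.

(** With [f p a b = 1], the space [N] is cut out by [f p a], [f p b] and [f a b]. Rank at most 2 at
    [p], [a], [b] gives [f (p, N, N) = f (a, N, N) = f (b, N, N) = 0], and rank at most 2 at [p + n]
    gives [f (N, N, N) = 0]. *)
Lemma no_rank4_null3 : no_rank4 -> null3 x.
Proof.
move=> H.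
have [[p [a [b pab0]]]|f0] := pselect (exists p a b, f p a b != 0); last first.
  exists 1%:M => [|i j l _ _]; first exact: unitmx1.
  apply/eqP/negPn/negP => ne; apply: f0; by do 3!eexists; exact: ne.
wlog pab : p a b pab0 / f p a b = 1.
  move=> W; apply: (W ((f p a b)^-1 *: p) a b); rewrite triZl mulVf //.
  exact: oner_neq0.
pose l1 := [:: f p a; f p b; f a b].
have lin1 i c u u' : nth (fun=> 0) l1 i (c *: u + u') =
     c * nth (fun=> 0) l1 i u + nth (fun=> 0) l1 i u'.
  by case: i => [|[|[|i]]]; rewrite /= ?triDr ?triZr ?nth_nil; ring.
have [n1 n10 K1] := common_zero (l := l1) isT lin1.
have [j1 j1P] := rV0Pn _ n10.
(* Requiring the coordinate [j1], nonzero on [n1], to vanish on [n2] makes the two independent; [n3]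
   is separated from both in the same way by [j1] and [j2]. *)
pose l2 := [:: f p a; f p b; f a b; (fun w => w 0 j1)].
have lin2 i c u u' : nth (fun=> 0) l2 i (c *: u + u') =
     c * nth (fun=> 0) l2 i u + nth (fun=> 0) l2 i u'.
  by case: i => [|[|[|[|i]]]]; rewrite /= ?triDr ?triZr ?nth_nil ?mxE; ring.
have [n2 n20 K2] := common_zero (l := l2) isT lin2.
have [j2 j2P] := rV0Pn _ n20.
pose l3 := [:: f p a; f p b; f a b; (fun w => w 0 j1); (fun w => w 0 j2)].
have lin3 i c u u' : nth (fun=> 0) l3 i (c *: u + u') =
     c * nth (fun=> 0) l3 i u + nth (fun=> 0) l3 i u'.
  by case: i => [|[|[|[|[|i]]]]]; rewrite /= ?triDr ?triZr ?nth_nil ?mxE; ring.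
have [n3 n30 K3] := common_zero (l := l3) isT lin3.
pose N n := [/\ f p a n = 0, f p b n = 0 & f a b n = 0].
have N1 : N n1 by split; [exact: (K1 0)|exact: (K1 1%N)|exact: (K1 2)].
have N2 : N n2 by split; [exact: (K2 0)|exact: (K2 1%N)|exact: (K2 2)].
have N3 : N n3 by split; [exact: (K3 0)|exact: (K3 1%N)|exact: (K3 2)].
have n2j1 : n2 0 j1 = 0 := K2 3.
have n3j1 : n3 0 j1 = 0 := K3 3.
have n3j2 : n3 0 j2 = 0 := K3 4.
have abp : f a b p = 1 by rewrite -tri_rot.
have bpa : f b p a = 1 by rewrite tri_rot.
have Np n n' : N n -> N n' -> f p n n' = 0.
  by move=> [h1 h2 h3] [h1' h2' h3']; apply: (H p a b).
have Na n n' : N n -> N n' -> f a n n' = 0.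
  move=> [h1 h2 h3] [h1' h2' h3']; apply: (H a b p) => //.
    by rewrite triC12 h1 oppr0.
  by rewrite triC12 h1' oppr0.
have Nb n n' : N n -> N n' -> f b n n' = 0.
  move=> [h1 h2 h3] [h1' h2' h3']; apply: (H b p a) => //;
  by rewrite triC12 ?h2 ?h3 ?h2' ?h3' oppr0.
have NN n n' n'' : N n -> N n' -> N n'' -> f n n' n'' = 0.
  move=> Nn Nn' Nn''; have [h1 h2 h3] := Nn; have [h1' h2' h3'] := Nn'.
  have [h1'' h2'' h3''] := Nn''.
  (* The pair [a], [b] is still hyperbolic for [p + n], and [n'], [n''] are still orthogonal to
     it. *)
  have -> : f n n' n'' = f (p + n) n' n'' by rewrite triDl Np // add0r.
  apply: (H _ a b); rewrite triDl.
  - by rewrite pab tri_rot h3 addr0.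
  - by rewrite h1' triC12 Na // oppr0 addr0.
  - by rewrite h2' triC12 Nb // oppr0 addr0.
  - by rewrite h1'' triC12 Na // oppr0 addr0.
  - by rewrite h2'' triC12 Nb // oppr0 addr0.
have gU : rows6 p a b n1 n2 n3 \in unitmx.
  apply: rows6_unit => z0 z1 z2 z3 z4 z5 E.
  have n1ab n : N n -> f n a b = 0 by case=> _ _ h; rewrite tri_rot.
  have n1bp n : N n -> f n b p = 0 by case=> _ h _; rewrite tri_rot triC12 h oppr0.
  have n1pa n : N n -> f n p a = 0 by case=> h _ _; rewrite tri_rot.
  have E1 := congr1 (fun y => f y a b) E.
  have E2 := congr1 (fun y => f y b p) E.
  have E3 := congr1 (fun y => f y p a) E.
  move: E1 E2 E3; rewrite /= !triL !tri0l.
  rewrite pab abp bpa !n1ab // !n1bp // !n1pa // !mulr0 !mulr1 !addr0 !add0r.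
  move=> z00 z10 z20; move: E; rewrite z00 z10 z20 !scale0r !add0r => E.
  have := congr1 (fun y : 'rV_6 => y 0 j1) E; rewrite !mxE n2j1 n3j1 !mulr0 !addr0.
  move=> /eqP; rewrite mulf_eq0 (negPf j1P) orbF => /eqP z30.
  move: E; rewrite z30 scale0r add0r => E.
  have := congr1 (fun y : 'rV_6 => y 0 j2) E; rewrite !mxE n3j2 !mulr0 !addr0.
  move=> /eqP; rewrite mulf_eq0 (negPf j2P) orbF => /eqP z40.
  move: E; rewrite z40 scale0r add0r => /eqP; rewrite scaler_eq0 (negPf n30) orbF.
  by move=> /eqP z50.
have NNW n n' w : N n -> N n' -> f n n' w = 0.
  move=> Nn Nn'; have [z0 [z1 [z2 [z3 [z4 [z5 ->]]]]]] := rows6_span w gU.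
  rewrite !triDr !triZr -!(tri_rot _ _ n n') Np // Na // Nb // !NN //; ring.
by apply: (null3_rows gU) => w; apply: NNW.
Qed.


Lemma rows6_free v0 v1 v2 v3 v4 v5 (z0 z1 z2 z3 z4 z5 : F) :
  rows6 v0 v1 v2 v3 v4 v5 \in unitmx ->
  z0 *: v0 + z1 *: v1 + z2 *: v2 + z3 *: v3 + z4 *: v4 + z5 *: v5 = 0 ->
  [/\ z0 = 0, z1 = 0 & z2 = 0] /\ [/\ z3 = 0, z4 = 0 & z5 = 0].
Proof.
move=> gU E; pose z : 'rV[F]_6 := \row_i [:: z0; z1; z2; z3; z4; z5]`_i.
have zg : z *m rows6 v0 v1 v2 v3 v4 v5 = 0 by rewrite mul_rows6 -[RHS]E !mxE !inordK.
have zE i : z 0 i = 0 by rewrite -(mulmxK gU z) zg mul0mx mxE.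
by split; split; [have := zE (o6 0)|have := zE (o6 1)|have := zE (o6 2)
  |have := zE (o6 3)|have := zE (o6 4)|have := zE (o6 5)]; rewrite mxE inordK.
Qed.

(** * A form [f p] of rank 4, with symplectic basis [a, b, c, d] and radical spanned by [p] and
    [q] *)

Section Rank4.
Variables (p q a b c d : 'rV[F]_6).
Hypothesis gU : rows6 p a b c d q \in unitmx.
Hypotheses (pab : f p a b = 1) (pcd : f p c d = 1).
Hypotheses (pac : f p a c = 0) (pbc : f p b c = 0) (pad : f p a d = 0) (pbd : f p b d = 0).
Hypothesis pq : forall w, f p q w = 0.

Let qp w : f q p w = 0. Proof. by rewrite triC12 pq oppr0. Qed.
Let qwp w : f q w p = 0. Proof. by rewrite -tri_rot pq. Qed.
Let pwq w : f p w q = 0. Proof. by rewrite triC23 pq oppr0. Qed.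
Let pba : f p b a = -1. Proof. by rewrite triC23 pab. Qed.
Let pca : f p c a = 0. Proof. by rewrite triC23 pac oppr0. Qed.
Let pcb : f p c b = 0. Proof. by rewrite triC23 pbc oppr0. Qed.
Let pda : f p d a = 0. Proof. by rewrite triC23 pad oppr0. Qed.
Let pdb : f p d b = 0. Proof. by rewrite triC23 pbd oppr0. Qed.
Let pdc : f p d c = -1. Proof. by rewrite triC23 pcd. Qed.
Let pE := (pab, pcd, pac, pbc, pad, pbd, pq, qp, qwp, pwq, pba, pca, pcb, pda, pdb, pdc).

(** On the span of [a, b, c, d] the form [f p] is nondegenerate, so [f q u] is represented by a
    vector, written here in the symplectic basis. The operator sending [u] to [v] will be
    multiplication by [T]. *)
Lemma rank4_adjoint u : exists v, forall w, f p v w = f q u w.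
Proof.
exists (f q u b *: a + (- f q u a) *: b + f q u d *: c + (- f q u c) *: d) => w.
have [z0 [z1 [z2 [z3 [z4 [z5 ->]]]]]] := rows6_span w gU.
rewrite !triL !pE; ring.
Qed.

(** The three copies of [A] are spanned by [(p, q)], [(u, v)] and [(u2, v2)], where [v] and [v2] are
    the adjoint images of [u] and [u2]. *)
Lemma rank4_nf u u2 : f p u u2 = 0 -> f q u u2 = 1 -> exists a b, GL_orbit x (nf a b).
Proof.
move=> pu qu; have [v vP] := rank4_adjoint u; have [v2 v2P] := rank4_adjoint u2.
have puv : f p u v = 0 by rewrite triC23 vP tri_alt23 oppr0.
have pu2v2 : f p u2 v2 = 0 by rewrite triC23 v2P tri_alt23 oppr0.
have puv2 : f p u v2 = 1 by rewrite triC23 v2P triC23 opprK.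
have pvu2 : f p v u2 = 1 by rewrite vP.
pose A := f p v v2.
have pvv2 : f p v v2 = A by [].
have quv2 : f q u v2 = A by rewrite -vP.
have qvu2 : f q v u2 = A by rewrite triC23 -v2P -triC23.
have quv : f q u v = 0 by rewrite -vP tri_alt23.
have qu2v2 : f q u2 v2 = 0 by rewrite -v2P tri_alt23.
(* Solved from the last coefficient of the normal form, [f q v v2 = A ^+ 2 - B]. *)
pose B := A ^+ 2 - f q v v2.
have qvv2 : f q v v2 = A ^+ 2 - B by rewrite /B; ring.
(* Adding multiples of [p] to [u, v, u2, v2] changes no value of [f p] or [f q], because
   [f p q = 0]. The four constants are chosen to kill the values on triples from these four
   vectors. *)
pose c1 := - f u v u2.
pose c2 := f u v v2 + c1 * A.
pose c3 := f u u2 v2.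
pose c4 := c3 * A - f v u2 v2.
exists A, B.
apply: (nf_orbit (g := rows6 p q (u + c1 *: p) (v + c2 *: p) (u2 + c3 *: p) (v2 + c4 *: p))).
have yp y z : f y p z = - f p y z by exact: triC12.
have yzp y z : f y z p = f p y z by rewrite -tri_rot.
have E1 : f u v u2 = - c1 by rewrite opprK.
have E2 : f u v v2 = c2 - c1 * A by rewrite /c2; ring.
have E3 : f u u2 v2 = c3 by [].
have E4 : f v u2 v2 = c3 * A - c4 by rewrite /c4; ring.
move: (c1) (c2) (c3) (c4) E1 E2 E3 E4 => k1 k2 k3 k4 E1 E2 E3 E4.
move=> i j l; rewrite !rowK /nf_coef.
case: i j l => [[|[|[|[|[|[|//]]]]]] Hi] [[|[|[|[|[|[|//]]]]]] Hj]
  [[|[|[|[|[|[|//]]]]]] Hl] //= _ _; clear Hi Hj Hl;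
rewrite !triL ?pq ?qp ?qwp ?pwq ?yp ?yzp ?tri_alt ?tri_alt23 ?tri_alt13
  ?pu ?qu ?puv ?pu2v2 ?puv2 ?pvu2 ?pvv2 ?quv2 ?qvu2 ?quv ?qu2v2 ?qvv2
  ?E1 ?E2 ?E3 ?E4; ring.
Qed.

(** The hypothesis forces [f q = l f p], so [q - l p] is in the radical of [f]. The isotropic pair
    [b], [d], corrected by multiples of [p], completes it to the null 3-space. *)
Lemma rank4_null3 : (forall u v, f p u v = 0 -> f q u v = 0) -> null3 x.
Proof.
move=> H; pose l := f q a b; pose s := f b d c; pose t := - f b d a.
have qab : f q a b = l by [].
have qba : f q b a = - l by rewrite triC23 qab.
have qdb : f q d b = 0 by apply: H; rewrite pdb.
have qbd : f q b d = 0 by apply: H; rewrite pbd.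
have qbc : f q b c = 0 by apply: H; rewrite pbc.
have qda : f q d a = 0 by apply: H; rewrite pda.
have qcb : f q c b = 0 by apply: H; rewrite pcb.
have qad : f q a d = 0 by apply: H; rewrite pad.
(* The vectors [a + c] and [b - d] are orthogonal for [f p], hence for [f q], which equates the
   values on the two hyperbolic pairs. *)
have qcd : f q c d = l.
  have := H (a + c) (b + (-1) *: d); rewrite !triL !pE qab qad qcb => E.
  by apply/eqP; rewrite eq_sym -subr_eq0; apply/eqP; rewrite -[RHS]E; ring.
have qdc : f q d c = - l by rewrite triC23 qcd.
have yp y z : f y p z = - f p y z by exact: triC12.
have yzp y z : f y z p = f p y z by rewrite -tri_rot.
have yq y z : f y q z = - f q y z by exact: triC12.
have yzq y z : f y z q = f q y z by rewrite -tri_rot.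
have bdc : f b d c = s by [].
have bda : f b d a = - t by rewrite opprK.
apply: (@null3_rows p a c (q + (- l) *: p) (b + s *: p) (d + t *: p)).
- apply: rows6_unit => z0 z1 z2 z3 z4 z5 E.
  have : [/\ z0 - l * z3 + s * z4 + t * z5 = 0, z1 = 0 & z4 = 0] /\
         [/\ z2 = 0, z5 = 0 & z3 = 0].
    apply: (rows6_free gU); rewrite -[RHS]E.
    by apply/rowP => i; rewrite !mxE; ring.
  case=> [[E0 -> z40] [-> z50 z30]]; move: E0; rewrite z40 z50 z30.
  by rewrite !mulr0 !addr0 subr0.
- move=> w; have [z0 [z1 [z2 [z3 [z4 [z5 ->]]]]]] := rows6_span w gU.
  rewrite !triL !(pE, yp, yzp, yq, yzq, qab, qba, qdb, qbd, qbc, qda, qcd, qdc); ring.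
- move=> w; have [z0 [z1 [z2 [z3 [z4 [z5 ->]]]]]] := rows6_span w gU.
  rewrite !triL !(pE, yp, yzp, yq, yzq, qab, qba, qdb, qbd, qbc, qda, qcd, qdc); ring.
- move=> w; have [z0 [z1 [z2 [z3 [z4 [z5 ->]]]]]] := rows6_span w gU.
  rewrite !triL !(pE, yp, yzp, yq, yzq, qab, qba, qdb, qbd, qbc, qda, qcd, qdc, bdc, bda); ring.
Qed.

End Rank4.

(** If some [f p] has rank 4, the alternative depends on whether [f q], for a second radical vector
    [q] of [f p], vanishes wherever [f p] does. *)
Lemma null3_or_nf : null3 x \/ exists a b, GL_orbit x (nf a b).
Proof.
have [/no_rank4_null3|] := pselect (no_rank4); first by left.
move=> nr.
have [p [a [b [c [d [pab [[pac pbc] [pad pbd]] pcd]]]]]] :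
  exists p a b c d, [/\ f p a b = 1, (f p a c = 0 /\ f p b c = 0) /\
    (f p a d = 0 /\ f p b d = 0) & f p c d = 1].
  apply/not_existsP => H; apply: nr => p a b c d h1 h2 h3 h4 h5.
  apply/eqP/negPn/negP => h; apply: (H p).
  exists a, b, c, ((f p c d)^-1 *: d).
  by rewrite !triZr h4 h5 mulr0 mulVf.
have p0 : p != 0 by apply: contra_eq_neq pab => ->; rewrite tri0l eq_sym oner_neq0.
have [j jP] := rV0Pn _ p0.
(* The last entry makes [q] independent of [p]; the others put it in the radical of [f p]. *)
pose l := [:: f p a; f p b; f p c; f p d; (fun w => w 0 j)].
have lin i k u u' : nth (fun=> 0) l i (k *: u + u') =
     k * nth (fun=> 0) l i u + nth (fun=> 0) l i u'.
  by case: i => [|[|[|[|[|i]]]]]; rewrite /= ?triDr ?triZr ?nth_nil ?mxE; ring.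
have [q q0 K] := common_zero (l := l) isT lin.
have paq : f p a q = 0 := K 0; have pbq : f p b q = 0 := K 1%N.
have pcq : f p c q = 0 := K 2; have pdq : f p d q = 0 := K 3.
have qj : q 0 j = 0 := K 4.
have pba : f p b a = -1 by rewrite triC23 pab.
have pca : f p c a = 0 by rewrite triC23 pac oppr0.
have pcb : f p c b = 0 by rewrite triC23 pbc oppr0.
have pda : f p d a = 0 by rewrite triC23 pad oppr0.
have pdb : f p d b = 0 by rewrite triC23 pbd oppr0.
have pdc : f p d c = -1 by rewrite triC23 pcd.
have pqa : f p q a = 0 by rewrite triC23 paq oppr0.
have pqb : f p q b = 0 by rewrite triC23 pbq oppr0.
have pqc : f p q c = 0 by rewrite triC23 pcq oppr0.
have pqd : f p q d = 0 by rewrite triC23 pdq oppr0.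
have gU : rows6 p a b c d q \in unitmx.
  apply: rows6_unit => z0 z1 z2 z3 z4 z5 E.
  have Ea := congr1 (f p a) E; have Eb := congr1 (f p b) E.
  have Ec := congr1 (f p c) E; have Ed := congr1 (f p d) E.
  have r0 y : f p y 0 = 0 by rewrite -tri_rot tri0l.
  move: Ea Eb Ec Ed; rewrite !triL pab pac pad pba pbc pbd pca pcb pcd pda pdb pdc.
  rewrite paq pbq pcq pdq !r0 !mulr0 !mulr1 !mulrN1 !(addr0, add0r).
  move=> z20 /eqP; rewrite oppr_eq0 => /eqP z10 z40 /eqP; rewrite oppr_eq0 => /eqP z30.
  move: E; rewrite z10 z20 z30 z40 !scale0r !addr0 => E.
  have := congr1 (fun y : 'rV_6 => y 0 j) E; rewrite !mxE qj mulr0 addr0.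
  move=> /eqP; rewrite mulf_eq0 (negPf jP) orbF => /eqP z00.
  move: E; rewrite z00 scale0r add0r => /eqP; rewrite scaler_eq0 (negPf q0) orbF.
  by move=> /eqP.
have pq w : f p q w = 0.
  have [z0 [z1 [z2 [z3 [z4 [z5 ->]]]]]] := rows6_span w gU.
  rewrite !triL pqa pqb pqc pqd; ring.
have [[u [u2 [pu qu]]]|H] := pselect (exists u u2, f p u u2 = 0 /\ f q u u2 != 0); last first.
  left; apply: (rank4_null3 gU) => // u v h; apply/eqP/negPn/negP => h'.
  by apply: H; exists u, v.
right; apply: (rank4_nf gU pab pcd pac pbc pad pbd pq (u := u) (u2 := (f q u u2)^-1 *: u2)).
  by rewrite triZr pu mulr0.
by rewrite triZr mulVf.
Qed.

End Classification.

(** * Unstable trivectors *)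

(** If [q] were nonzero, [q * 'X + 1] would be nonconstant and so have a root; but its value is 1 at
    0 and, by hypothesis, everywhere else. *)
Lemma closed_poly0 (K : closedFieldType) (q : {poly K}) :
  (forall t, t != 0 -> q.[t] = 0) -> q = 0.
Proof.
move=> H; apply/eqP/negPn/negP => q0.
have sz : size (q * 'X + 1) = (size q).+1.
  by rewrite -[1]/(1%:P) size_MXaddC (negPf q0).
have /closed_rootP[t] : size (q * 'X + 1) != 1 by rewrite sz eqSS size_poly_eq0.
rewrite /root !hornerE; have [->|/H ->] := eqVneq t 0.
  by rewrite mulr0 add0r oner_eq0.
by rewrite mul0r add0r oner_eq0.
Qed.

Lemma horner_mmap (K : comNzRingType) n (v : 'I_n -> {poly K}) (p : {mpoly K[n]}) (t : K) :
  (mmap polyC v p).[t] = p.@[fun i => (v i).[t]].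
Proof.
rewrite mevalE /mmap horner_sum; apply: eq_bigr => m _.
rewrite hornerM hornerC /mmap1 horner_prod; congr (_ * _).
by apply: eq_bigr => i _; rewrite horner_exp.
Qed.

Lemma extmx_diag (R : comNzRingType) r n (d : 'rV[R]_n) (x : extpow R r n) i :
  (extmx r (diag_mx d) *m x) i 0 = (\prod_a d 0 (ext_idx i a)) * x i 0.
Proof.
rewrite extmxE.
have -> : rowsub (ext_idx i) (diag_mx d) =
    diag_mx (\row_a d 0 (ext_idx i a)) *m rowsub (ext_idx i) 1%:M.
  by apply/matrixP => a b; rewrite mul_diag_mx !mxE mulr_natr.
rewrite altform_mulmx det_diag altform_idx; congr (_ * _).
by apply: eq_bigr => a _; rewrite mxE.
Qed.

(* The one-parameter group diag(t,t,t,1/t,1/t,1/t), in a basis whose last three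
   vectors span the null space, contracts the orbit to 0. *)
Lemma null3_closure (K : closedFieldType) (y : extpow K 3 6) :
  null3 y -> zariski_closure (SL_orbit y) 0.
Proof.
move=> [g gU H] Z [[P ->] sub] p Pp /=.
pose d (t : K) : 'rV[K]_6 := \row_i (if (i < 3)%N then t else t^-1).
pose D t := diag_mx (d t).
have [z zE] : exists z, z = extmx 3 g *m y by eexists.
pose top (i : 'I_(ext_dim 3 6)) := (ext_idx i (lift 0 (lift 0 0))%R < 3)%N.
pose z1 : extpow K 3 6 := \col_i (if top i then 0 else z i 0).
pose z3 : extpow K 3 6 := \col_i (if top i then z i 0 else 0).
have zD (t : K) : t != 0 -> extmx 3 (D t) *m z = t *: z1 + t ^+ 3 *: z3.
  move=> t0; apply/colP => i; rewrite extmx_diag.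
  have -> : \prod_a d t 0 (ext_idx i a) = d t 0 (ext_idx i 0) *
      (d t 0 (ext_idx i (lift 0 0)) * d t 0 (ext_idx i (lift 0 (lift 0 0)))).
    by rewrite !big_ord_recl big_ord0 mulr1.
  have lt01 : (ext_idx i 0%R < ext_idx i (lift 0 0)%R)%N by rewrite ext_idx_mono.
  have lt12 : (ext_idx i (lift 0 0)%R < ext_idx i (lift 0 (lift 0 0))%R)%N.
    by rewrite ext_idx_mono.
  rewrite ![in RHS]mxE /top 3![d _ _ _]mxE.
  (* Monotonicity leaves four cases. Three indices below 3 give weight [t ^+ 3], exactly two give
     weight [t], and with fewer the coordinate is zero because two of the rows lie in the null
     space. *)
  case: ltnP => t2; case: ltnP => t1; case: ltnP => h0; try lia.
  - ring.
  - by field.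
  - rewrite zE extmx_tri tri_rot H ?mulr0 ?addr0 //.
  - rewrite zE extmx_tri tri_rot H ?mulr0 ?addr0 //.
pose w1 := extmx 3 (invmx g) *m z1; pose w3 := extmx 3 (invmx g) *m z3.
have orb (t : K) : t != 0 -> SL_orbit y (t *: w1 + t ^+ 3 *: w3).
  move=> t0; exists (invmx g *m (D t *m g)) => /=.
    rewrite !det_mulmx mulrCA -det_mulmx mulVmx // det1 mulr1.
    rewrite det_diag !big_ord_recl big_ord0 !mxE /=; by field.
  by rewrite !extmxM -zE zD // mulmxDr -!scalemxAr.
move: w1 w3 orb => w1 w3 orb.
pose v i := (w1 i 0)%:P * 'X + (w3 i 0)%:P * 'X^3.
have vt t i : (v i).[t] = (t *: w1 + t ^+ 3 *: w3) i 0.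
  by rewrite hornerD hornerCM hornerX hornerCM hornerXn !mxE; ring.
(* Along the curve, [p] becomes a polynomial in [t] vanishing for all nonzero [t], hence also at 0,
   where the curve reaches the origin. *)
have q0 : mmap polyC v p = 0.
  apply: closed_poly0 => t t0; rewrite horner_mmap.
  rewrite (meval_eq (v2 := fun i => (t *: w1 + t ^+ 3 *: w3) i 0)); last exact: vt.
  exact: (sub _ (orb t t0)).
have := horner_mmap v p 0; rewrite q0 horner0 => ->.
by apply: meval_eq => i; rewrite vt expr0n /= !scale0r addr0.
Qed.

(** * An invariant of sums of two decomposables *)

(** The same block matrix is factored in two ways, with Schur complements [1 + u v] and
    [1 + v u]. *)
Lemma det_1Dmul (R : comNzRingType) n (u : 'cV[R]_n) (v : 'rV[R]_n) :
  \det (1%:M + u *m v) = 1 + (v *m u) 0 0.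
Proof.
have E1 : block_mx 1%:M (- v) u 1%:M =
    block_mx 1%:M 0 u 1%:M *m block_mx 1%:M (- v) 0 (1%:M + u *m v).
  by rewrite mulmx_block !mul1mx !mul0mx ?mulmx0 !mulmx1 !addr0 mulmxN addrC addrK.
have E2 : block_mx 1%:M (- v) u 1%:M =
    block_mx (1%:M + v *m u) (- v) 0 1%:M *m block_mx 1%:M 0 u 1%:M.
  by rewrite mulmx_block !mul1mx !mul0mx !mulmx0 ?mulmx1 !add0r mulNmx addrK.
have := congr1 determinant E1; rewrite E2 !det_mulmx !det_lblock !det_ublock !det1 !mul1r !mulr1.
by move=> <-; rewrite det_mx11 !mxE eqxx.
Qed.

Section WedgePairing.
Variables (R : comNzRingType) (r : nat).
Local Notation V := (extpow R r (r + r)).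

Definition ebasis (s : 'I_r -> 'I_(r + r)) : 'M[R]_(r + r, r) := colsub s 1%:M.

(** The wedge product of [x] and [y], read as a scalar in the top exterior power. *)
Definition wpair (x y : V) : R :=
  \sum_i \sum_j x i 0 * y j 0 * \det (row_mx (ebasis (ext_idx i)) (ebasis (ext_idx j))).

Lemma wpairDl x x' y : wpair (x + x') y = wpair x y + wpair x' y.
Proof.
rewrite -big_split; apply: eq_bigr => i _; rewrite -big_split.
by apply: eq_bigr => j _; rewrite !mxE !mulrDl.
Qed.

Lemma wpairDr x y y' : wpair x (y + y') = wpair x y + wpair x y'.
Proof.
rewrite -big_split; apply: eq_bigr => i _; rewrite -big_split.
by apply: eq_bigr => j _; rewrite !mxE mulrDr !mulrDl.
Qed.

(* Since [delta_mx j i] has rank one, the perturbation is affine in it, and this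
   difference is the wedge of [x] with the image of [x] under the derivation
   of the exterior algebra extending [delta_mx j i]. *)
Definition smx (x : V) : 'M[R]_(r + r) :=
  \matrix_(i, j) (wpair (extmx r (1%:M + delta_mx j i) *m x) x - wpair x x).

Definition swapmx : 'M[R]_(r + r) := block_mx 0 1%:M 1%:M 0.

(** Exchanging the two halves is an involution. Its determinant is kept as an unevaluated sign,
    which treats all characteristics and all [r] alike. *)
Lemma swapmx_det : \det swapmx * \det swapmx = 1.
Proof.
rewrite -det_mulmx /swapmx mulmx_block !mul0mx !mul1mx ?mulmx0 !add0r !addr0.
by rewrite -scalar_mx_block det1.
Qed.

Lemma swapmx_det_neq0 : \det swapmx != 0.
Proof.
by apply/eqP => e0; move: swapmx_det => /eqP; rewrite e0 mul0r eq_sym oner_eq0.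
Qed.

Lemma det_row_mxC (A B : 'M[R]_(r + r, r)) :
  \det (row_mx B A) = \det swapmx * \det (row_mx A B).
Proof.
rewrite mulrC -det_mulmx /swapmx mul_row_block !mulmx0 !mulmx1 add0r addr0 //.
Qed.

End WedgePairing.

Lemma wpair_map (R S : comNzRingType) (f : {rmorphism R -> S}) r
    (x y : extpow R r (r + r)) :
  wpair (map_mx f x) (map_mx f y) = f (wpair x y).
Proof.
rewrite rmorph_sum; apply: eq_bigr => i _; rewrite rmorph_sum; apply: eq_bigr => j _.
rewrite !rmorphM !mxE -det_map_mx map_row_mx; congr (_ * \det (row_mx _ _));
  by apply/matrixP => a b; rewrite !mxE rmorph_nat.
Qed.

(** Applied to evaluation at a point, this makes [\det (smx X)], for [X] the vector of
    indeterminates, a polynomial with value [\det (smx y)] at [y]. *)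
Lemma smx_map (R S : comNzRingType) (f : {rmorphism R -> S}) r
    (x : extpow R r (r + r)) :
  smx (map_mx f x) = map_mx f (smx x).
Proof.
apply/matrixP => i j; rewrite !mxE rmorphB -!wpair_map extmx_map.
by rewrite map_mxD map_mx1 map_delta_mx.
Qed.

Section WedgeField.
Variables (F : fieldType) (r : nat).
Implicit Types A B C : 'M[F]_(r + r, r).

(* Completing [A] to a basis, [\det (row_mx A B)] is a multiple of
   [\det (N *m B)] for a fixed [N], to which Cauchy-Binet applies. *)
Lemma det_row_mx_wedger A B : \det (row_mx A B) =
  \sum_j \det (row_mx A (ebasis F (ext_idx j))) * wedge B j 0.
Proof.
(* If [A] cannot be completed to an invertible matrix, every determinant on both sides is zero. *)
have [[C hU]|nC] := pselect (exists C, row_mx A C \in unitmx); last first.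
  have d0 D : \det (row_mx A D) = 0.
    by apply/eqP/negPn/negP => d; apply: nC; exists D; rewrite unitmxE unitfE.
  by rewrite d0 big1 // => j _; rewrite d0 mul0r.
set h := row_mx A C in hU.
have NA : invmx h *m A = col_mx 1%:M 0.
  by rewrite -[A in LHS](_ : h *m col_mx 1%:M 0 = A) ?mulKmx // mul_row_col mulmx1 mulmx0 addr0.
have key D : \det (row_mx A D) = \det h * \det (dsubmx (invmx h) *m D).
  rewrite -{1}(mulKVmx hU (row_mx A D)) det_mulmx; congr (_ * _).
  rewrite mul_mx_row NA -[invmx h *m D]vsubmxK.
  by rewrite -block_mxEh det_ublock det1 mul1r -mul_dsub_mx.
rewrite key -altform_wedge /altform big_distrr; apply: eq_bigr => j _ /=.
rewrite mulrA key; congr (_ * \det _ * _).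
by rewrite /ebasis; apply/matrixP => a b; rewrite !mxE (bigD1 (ext_idx j b)) //= !mxE eqxx mulr1
  big1 ?addr0 // => l /negPf lb; rewrite !mxE lb mulr0.
Qed.

Lemma det_row_mx_wedgel A B : \det (row_mx A B) =
  \sum_i \det (row_mx (ebasis F (ext_idx i)) B) * wedge A i 0.
Proof.
rewrite det_row_mxC det_row_mx_wedger big_distrr; apply: eq_bigr => i _ /=.
by rewrite mulrA -det_row_mxC.
Qed.

Lemma wpair_wedge A B : wpair (wedge A) (wedge B) = \det (row_mx A B).
Proof.
rewrite det_row_mx_wedgel; apply: eq_bigr => i _.
rewrite det_row_mx_wedger big_distrl; apply: eq_bigr => j _ /=; ring.
Qed.

(** The perturbed matrix is [h] times the identity plus a rank one matrix, so [det_1Dmul] applies;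
    the result is an entry of the projector onto the span of [A] along that of [B]. *)
Lemma det_row_mx_perturb A B i j (h := row_mx A B) : h \in unitmx ->
  \det (row_mx ((1%:M + delta_mx j i) *m A) B) - \det h =
  \det h * (h *m block_mx 1%:M 0 0 0 *m invmx h) i j.
Proof.
move=> hU.
have E : row_mx ((1%:M + delta_mx j i) *m A) B =
    h *m (1%:M + (invmx h *m delta_mx j 0) *m (row i (h *m block_mx 1%:M 0 0 0)) ).
  rewrite mulmxDr mulmx1 mulmxA mulKVmx // rowE !mulmxA mul_delta_mx.
  rewrite -mulmxA /h mul_row_block !mulmx0 !mulmx1 !addr0 mul_mx_row mulmx0.
  by rewrite add_row_mx addr0 mulmxDl mul1mx.
rewrite E det_mulmx det_1Dmul mulrDr mulr1 addrC addKr; congr (_ * _).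
rewrite -colE mxE [RHS]mxE; apply: eq_bigr => l _.
by rewrite [row _ _ _ _]mxE [col _ _ _ _]mxE.
Qed.


(** An invertible [row_mx A B] would preserve the rank [r] of [col_mx 1 (-1)], which it sends to
    [A - B]. *)
Lemma det_row_mx_rank A B : (\rank (A - B)%R < r)%N -> \det (row_mx A B) = 0.
Proof.
move=> rk; apply/eqP/negPn/negP => d.
have hU : row_mx A B \in unitmx by rewrite unitmxE unitfE.
have E : row_mx A B *m col_mx 1%:M (- 1%:M) = A - B.
  by rewrite mul_row_col mulmx1 mulmxN mulmx1.
have : (\rank (col_mx 1%:M (- 1%:M) : 'M[F]_(r + r, r)) < r)%N.
  by rewrite -[col_mx _ _](mulKmx hU) E; apply: leq_ltn_trans (mxrankM_maxr _ _) rk.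
have := mxrankM_maxr (row_mx 1%:M 0) (col_mx 1%:M (- 1%:M) : 'M[F]_(r + r, r)).
by rewrite mul_row_col mulmx1 mul0mx addr0 mxrank1 ltnNge => ->.
Qed.

(** The terms pairing [A] with [A], or [B] with [B], vanish since a rank one perturbation changes a
    matrix by rank less than [r]. The two mixed terms give the projectors onto the spans of [A] and
    [B], the second with the sign [e] of the exchange. *)
Lemma smx_wedge A B (h := row_mx A B) (e := \det (swapmx F r)) :
  (1 < r)%N -> h \in unitmx ->
  smx (wedge A + wedge B) = \det h *: (h *m block_mx 1%:M 0 0 e%:M *m invmx h).
Proof.
move=> r1 hU; apply/matrixP => i j.
have self C : \det (row_mx ((1%:M + delta_mx j i) *m C) C) = 0.
  apply: det_row_mx_rank; rewrite mulmxDl mul1mx addrC addKr.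
  by apply: leq_ltn_trans (mxrankM_maxl _ _) _; rewrite mxrank_delta.
have self0 C : \det (row_mx C C) = 0.
  by apply: det_row_mx_rank; rewrite subrr mxrank0 ltnW.
have h'U : row_mx B A \in unitmx.
  have hd : \det h \is a GRing.unit by rewrite -unitmxE.
  rewrite unitmxE det_row_mxC unitrM hd andbT unitfE.
  exact: swapmx_det_neq0.
rewrite [LHS]mxE mulmxDr !extmx_wedge !wpairDl !wpairDr !wpair_wedge !self !self0.
have EA := det_row_mx_perturb i j hU.
have EB := det_row_mx_perturb i j h'U.
transitivity ((\det (row_mx ((1%:M + delta_mx j i) *m A) B) - \det h) +
  (\det (row_mx ((1%:M + delta_mx j i) *m B) A) - \det (row_mx B A))).
  rewrite -/h; ring.
rewrite EA EB (det_row_mxC A B) -/h -/e.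
have -> : invmx (row_mx B A) = swapmx F r *m invmx h.
  apply: (can_inj (mulKmx h'U)); rewrite mulmxV // mulmxA /swapmx mul_row_block.
  by rewrite !mulmx0 !mulmx1 add0r addr0 mulmxV.
rewrite [row_mx B A *m _](_ : _ = h *m block_mx 0 0 1%:M 0); last first.
  by rewrite /h !mul_row_block !mulmx0 !mulmx1 !addr0 ?add0r.
rewrite mulmxA -[h *m _ *m swapmx F r]mulmxA /swapmx mulmx_block.
rewrite !mul0mx !mulmx0 !mul1mx !addr0.
have -> : block_mx 1%:M 0 0 e%:M =
    block_mx 1%:M 0 0 0 + e *: block_mx 0 0 0 1%:M :> 'M[F]_(r + r).
  by rewrite scale_block_mx add_block_mx !scaler0 !addr0 add0r scale_scalar_mx mulr1.
rewrite mulmxDr mulmxDl -scalemxAr -scalemxAl.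
have sE (c : F) (M : 'M[F]_(r + r)) : (c *: M) i j = c * M i j by rewrite mxE.
rewrite [RHS]sE [in RHS]mxE sE; ring.
Qed.

End WedgeField.

Lemma smx_wedge_det (F : fieldType) r (A B : 'M[F]_(r + r, r)) :
  (1 < r)%N -> row_mx A B \in unitmx ->
  \det (smx (wedge A + wedge B)) =
  \det (row_mx A B) ^+ (r + r) * \det (swapmx F r) ^+ r.
Proof.
move=> r1 hU; rewrite smx_wedge // detZ; congr (_ * _).
rewrite !det_mulmx mulrAC -det_mulmx mulmxV // det1 mul1r.
by rewrite det_ublock det1 mul1r det_scalar.
Qed.

Lemma wedge_sum_semistable (K : fieldType) (A B : 'M[K]_(3 + 3, 3)) :
  row_mx A B \in unitmx ->
  ~ zariski_closure (SL_orbit (wedge A + wedge B : extpow K 3 6)) 0.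
Proof.
move=> hU; pose X : extpow {mpoly K[ext_dim 3 6]} 3 (3 + 3) := \col_i 'X_i.
pose p : {mpoly K[ext_dim 3 6]} := \det (smx X).
have pE (y : extpow K 3 (3 + 3)) : p.@[fun i => y i 0] = \det (smx y).
  rewrite /p -det_map_mx -smx_map; congr (\det (smx _)).
  by apply/colP => i; rewrite !mxE; exact: mevalXU.
set c := \det (smx (wedge A + wedge B)).
have c0 : c != 0.
  rewrite /c smx_wedge_det // mulf_neq0 ?expf_neq0 //.
    by rewrite -unitfE -unitmxE.
  exact: swapmx_det_neq0.
(* This hypersurface contains the orbit, as [\det g = 1], but not 0, as [smx 0 = 0] and [c] is
   nonzero. *)
pose Z := [set y : extpow K 3 6 | p.@[fun i => y i 0] - c = 0]%classic.
move=> /(_ Z) cl; have : Z 0; last first.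
  rewrite /Z /= (pE 0) (_ : smx 0 = 0).
    by rewrite det0 sub0r => /eqP; rewrite oppr_eq0 (negPf c0).
  apply/matrixP => i j; rewrite !mxE mulmx0 subrr //.
apply: cl; split.
  exists [set p - c%:MP]%classic; apply/seteqP; split => y /=.
    by move=> E q ->; rewrite mevalB mevalC.
  by move=> /(_ _ erefl); rewrite mevalB mevalC.
move=> _ [g /= g1 <-]; rewrite /Z /=.
have gU : g *m row_mx A B \in unitmx by rewrite unitmx_mul hU unitmxE g1 unitr1.
rewrite mulmxDr !extmx_wedge (pE (wedge (g *m A) + wedge (g *m B))).
rewrite mul_mx_row in gU; rewrite smx_wedge_det // /c smx_wedge_det // -mul_mx_row.
by rewrite det_mulmx g1 mul1r subrr.
Qed.

(** * Orbits of normal forms *)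

Section NormalFormField.
Variable F : fieldType.
Implicit Types (a b m n l : F) (u v w : 'rV[F]_6).

Definition vec6 (c0 c1 c2 c3 c4 c5 : F) : 'rV[F]_6 :=
  \row_i [:: c0; c1; c2; c3; c4; c5]`_i.

(* The substitution ['T := m + n 'T] in each copy of the quadratic algebra
   multiplies [tau] by [n]; dividing the first copy by [n] compensates. *)
Lemma nf_subst a b m n : n != 0 ->
  GL_orbit (nf a b) (nf (2 * m + n * a) (m ^+ 2 + m * n * a + n ^+ 2 * b)).
Proof.
move=> n0.
apply: (nf_orbit (g := rows6 (vec6 n^-1 0 0 0 0 0) (vec6 (m / n) 1 0 0 0 0)
  (vec6 0 0 1 0 0 0) (vec6 0 0 m n 0 0) (vec6 0 0 0 0 1 0) (vec6 0 0 0 0 m n))).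
move=> i j l; rewrite !rowK /nf_coef.
case: i j l => [[|[|[|[|[|[|//]]]]]] Hi] [[|[|[|[|[|[|//]]]]]] Hj]
  [[|[|[|[|[|[|//]]]]]] Hl] //= _ _; clear Hi Hj Hl;
rewrite tri_nf /det_at !mxE !inordK //=; by [ring | field].
Qed.

(** Here [A = F[T]/((T - l)^2)], and the null space is [(T - l) A^3]: a product of two of its
    coordinates is divisible by [(T - l)^2 = 0]. *)
Lemma nf_double_null3 l : null3 (nf (2 * l) (l ^+ 2)).
Proof.
apply: (@null3_rows _ _ (vec6 1 0 0 0 0 0) (vec6 0 0 1 0 0 0) (vec6 0 0 0 0 1 0)
  (vec6 (- l) 1 0 0 0 0) (vec6 0 0 (- l) 1 0 0) (vec6 0 0 0 0 (- l) 1)).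
- apply: rows6_unit => z0 z1 z2 z3 z4 z5 E.
  have C k := congr1 (fun y : 'rV_6 => y 0 (o6 k)) E.
  have := C 0%N; have := C 1%N; have := C 2; have := C 3; have := C 4; have := C 5.
  rewrite !mxE !inordK //= !mulr0 !mulr1 !addr0 !add0r => -> z2E -> z1E -> z0E.
  by move: z0E z1E z2E; rewrite !mul0r !addr0.
- move=> w; rewrite tri_nf /det_at !mxE !inordK //=; ring.
- move=> w; rewrite tri_nf /det_at !mxE !inordK //=; ring.
- move=> w; rewrite tri_nf /det_at !mxE !inordK //=; ring.
Qed.

(** The map from [A^3] to [F^3] given by sending [T] to [r], with the first coordinate scaled by
    [c]. *)
Definition root_cols (c r : F) : 'M[F]_(6, 3) :=
  \matrix_(i < 6, j < 3) ((if j == 0 then c else 1) *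
     (if i == j.*2 :> nat then 1 else if i == j.*2.+1 :> nat then r else 0)).

Lemma tri_root_cols c r u v w (e := fun (y : 'rV[F]_6) k => y 0 (o6 k.*2) + r * y 0 (o6 k.*2.+1)) :
  tri (wedge (root_cols c r)) u v w = c *
   (e u 0%N * (e v 1%N * e w 2 - e v 2 * e w 1%N)
    - e u 1%N * (e v 0%N * e w 2 - e v 2 * e w 0%N)
    + e u 2 * (e v 0%N * e w 1%N - e v 1%N * e w 0%N)).
Proof.
rewrite /tri altform_wedge.
have E i j : (row3 u v w *m root_cols c r) i j =
    (if j == 0 then c else 1) * e [:: u; v; w]`_i j.
  rewrite -[LHS](_ : (row i (row3 u v w) *m root_cols c r) 0 j = _); last first.
    by rewrite -row_mul mxE.
  rewrite rowK; move: (nth _ _ _) => y.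
  have [yn ynE] : exists yn, forall k, yn k = y 0 (o6 k) by eexists.
  have yE (k : 'I_6) : y 0 k = yn k by rewrite ynE /o6 inord_val.
  rewrite mxE !big_ord_recl big_ord0 /e -!ynE !yE !mxE.
  by case: j => [[|[|[|//]]] Hj] /=; rewrite /bump /=; ring.
rewrite det_mx33 !E /=; ring.
Qed.

(** With distinct roots, [A] is [F * F] by evaluation of [T] at [r] and [s], and [tau] is the
    difference of the two values divided by [r - s]. A vector killed by both evaluations is in the
    radical of the form, hence zero. *)
Lemma nf_split r s : r != s -> exists A B : 'M[F]_(3 + 3, 3),
  row_mx A B \in unitmx /\ nf (r + s) (r * s) = wedge A + wedge B :> extpow F 3 6.
Proof.
move=> rs; have rs0 : r - s != 0 by rewrite subr_eq0.
pose A := root_cols (r - s)^-1 r; pose B := root_cols (- (r - s)^-1) s.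
have triE u v w : tri (nf (r + s) (r * s)) u v w =
    tri (wedge A) u v w + tri (wedge B) u v w.
  rewrite tri_nf !tri_root_cols /det_at /double /=; field.
  exact: rs0.
exists A, B; split; last first.
  apply/colP => i; rewrite coord_tri triE [RHS]mxE.
  by rewrite [wedge A i 0]coord_tri [wedge B i 0]coord_tri.
rewrite -row_free_unit; apply: inj_row_free => z; rewrite mul_mx_row.
move=> E; have [zA zB] : z *m A = 0 /\ z *m B = 0.
  by apply: eq_row_mx; rewrite E row_mx0.
apply: (@nf_nondeg _ (r + s) (r * s)) => v w; rewrite triE.
have z0 (C : 'M[F]_(6, 3)) : z *m C = 0 -> tri (wedge C) z v w = 0.
  move=> zC; rewrite /tri altform_wedge; apply/eqP/det0P.
  exists (delta_mx 0 0); last by rewrite mulmxA -rowE rowK.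
  by apply/rV0Pn; exists 0; rewrite mxE !eqxx oner_neq0.
by rewrite !z0 // addr0.
Qed.

(** The vanishing of all 4 by 4 Pfaffians expresses that [tri x v] has rank at most 2. *)
Definition splits (x : extpow F 3 6) : Prop :=
  exists2 v : 'rV[F]_6, v != 0 & forall c d c' d',
    tri x v c d * tri x v c' d' - tri x v c c' * tri x v d d' +
    tri x v c d' * tri x v d c' = 0.

Lemma splits_extmx x g : g \in unitmx -> splits x <-> splits (extmx 3 g *m x).
Proof.
move=> gU; split=> -[v v0 H].
  exists (v *m invmx g).
    by apply: contraNneq v0 => E; rewrite -(mulmxKV gU v) E mul0mx.
  by move=> c d c' d'; rewrite !tri_extmx mulmxKV.
exists (v *m g); first by apply: contraNneq v0 => E; rewrite -(mulmxK gU v) E mul0mx.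
move=> c d c' d'.
rewrite -[c](mulmxKV gU) -[d](mulmxKV gU) -[c'](mulmxKV gU) -[d'](mulmxKV gU).
by rewrite -!tri_extmx.
Qed.

Lemma splitsZ x t : t != 0 -> splits x <-> splits (t *: x).
Proof.
move=> t0; have E v c d : tri (t *: x) v c d = t * tri x v c d by rewrite /tri altformZ.
have E2 v c d c' d' : tri (t *: x) v c d * tri (t *: x) v c' d'
    - tri (t *: x) v c c' * tri (t *: x) v d d' +
    tri (t *: x) v c d' * tri (t *: x) v d c' = t ^+ 2 *
    (tri x v c d * tri x v c' d' - tri x v c c' * tri x v d d' +
    tri x v c d' * tri x v d c') by rewrite !E; ring.
split=> -[v v0 H]; exists v => // c d c' d'; first by rewrite E2 H mulr0.
have /eqP := H c d c' d'; rewrite E2 mulf_eq0 expf_eq0 (negPf t0) /=.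
by move=> /eqP.
Qed.

(** For [v] in one copy of [A], the Pfaffian on the other two is the norm of [v], so rank at most 2
    yields an element of norm zero and thereby a root. *)
Lemma splits_nf a b : splits (nf a b) <-> exists l, l ^+ 2 - a * l + b = 0.
Proof.
split=> [[v v0 H]|[l lE]]; last first.
  have bE : b = a * l - l ^+ 2 by rewrite -[RHS]addr0 -lE; ring.
  (* The zero divisor [T + l - a], annihilated by [T - l], placed in the first copy; its form
     factors through evaluation of [T] at [l]. *)
  exists (vec6 (l - a) 1 0 0 0 0).
    by apply/rV0Pn; exists (o6 1); rewrite mxE inordK //= oner_neq0.
  have E c d : tri (nf a b) (vec6 (l - a) 1 0 0 0 0) c d =
    (c 0 (o6 2) + l * c 0 (o6 3)) * (d 0 (o6 4) + l * d 0 (o6 5)) -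
    (c 0 (o6 4) + l * c 0 (o6 5)) * (d 0 (o6 2) + l * d 0 (o6 3)).
    rewrite tri_nf /det_at ![vec6 _ _ _ _ _ _ _ _]mxE !inordK //= bE; ring.
  by move=> c d c' d'; rewrite !E; ring.
have root (m n : F) : ~~ ((m == 0) && (n == 0)) -> m ^+ 2 + m * n * a + n ^+ 2 * b = 0 ->
    exists l, l ^+ 2 - a * l + b = 0.
  move=> mn0 E; have [n0|n0] := eqVneq n 0.
    move: E mn0; rewrite n0 mulr0 mul0r expr0n /= mul0r !addr0 => /eqP.
    by rewrite expf_eq0 /= => ->; rewrite eqxx.
  (* The norm of [m + n T] is [n ^+ 2] times the value of the polynomial at [- m / n]. *)
  exists (- m / n); apply: (mulfI (expf_neq0 2 n0)); rewrite mulr0 -[RHS]E.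
  by field.
pose e k : 'rV[F]_6 := delta_mx 0 (o6 k).
have v01 : v 0 (o6 0) ^+ 2 + v 0 (o6 0) * v 0 (o6 1) * a + v 0 (o6 1) ^+ 2 * b = 0.
  have := H (e 2) (e 3) (e 4) (e 5); rewrite !tri_nf_delta //= => E'.
  by rewrite -[RHS]E'; ring.
have v23 : v 0 (o6 2) ^+ 2 + v 0 (o6 2) * v 0 (o6 3) * a + v 0 (o6 3) ^+ 2 * b = 0.
  have := H (e 0%N) (e 1%N) (e 4) (e 5); rewrite !tri_nf_delta //= => E'.
  by rewrite -[RHS]E'; ring.
have v45 : v 0 (o6 4) ^+ 2 + v 0 (o6 4) * v 0 (o6 5) * a + v 0 (o6 5) ^+ 2 * b = 0.
  have := H (e 0%N) (e 1%N) (e 2) (e 3); rewrite !tri_nf_delta //= => E'.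
  by rewrite -[RHS]E'; ring.
have [/andP[/eqP a0 /eqP a1]|h] := boolP ((v 0 (o6 0) == 0) && (v 0 (o6 1) == 0));
  last exact: root h v01.
have [/andP[/eqP a2 /eqP a3]|h] := boolP ((v 0 (o6 2) == 0) && (v 0 (o6 3) == 0));
  last exact: root h v23.
have [/andP[/eqP a4 /eqP a5]|h] := boolP ((v 0 (o6 4) == 0) && (v 0 (o6 5) == 0));
  last exact: root h v45.
case/eqP: v0; apply/rowP => i; rewrite mxE -(inord_val i).
by case: i => [[|[|[|[|[|[|//]]]]]] Hi].
Qed.

End NormalFormField.

(** * Quadratic extensions *)

Lemma size_quad (F : fieldType) (a b : F) : size ('X^2 - a *: 'X + b%:P) = 3.
Proof.
rewrite -addrA size_polyDl size_polyXn // ltnS.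
apply: leq_trans (size_polyD _ _) _; rewrite geq_max size_polyN.
by rewrite (leq_trans (size_scale_leq _ _)) ?size_polyX // (leq_trans (size_polyC_leq1 _)).
Qed.

Section QuadraticExtensions.
Variable k : fieldType.
Implicit Types (L M : fieldExtType k) (a b m n : k).

Definition embeds L M : Prop := inhabited {lrmorphism L -> M}.

Definition quad_root M a b : Prop :=
  exists z : M, z ^+ 2 - in_alg M a * z + in_alg M b = 0.

Lemma lrmorph_alg L M (f : {lrmorphism L -> M}) a : f (in_alg L a) = in_alg M a.
Proof. by rewrite rmorph_alg. Qed.

Lemma embeds_quad_root L M a b : embeds L M -> quad_root L a b -> quad_root M a b.
Proof.
move=> [f] [z E]; exists (f z).
by rewrite -!(lrmorph_alg f) -rmorphXn -rmorphM -rmorphB -rmorphD E rmorph0.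
Qed.

Lemma embeds_refl L : embeds L L.
Proof. by constructor; exact: idfun. Qed.

Lemma embeds_trans L M N : embeds L M -> embeds M N -> embeds L N.
Proof. by move=> [f] [g]; constructor; exact: (g \o f). Qed.

Lemma ext_isom_embeds L M : ext_isom L M -> embeds L M /\ embeds M L.
Proof.
move=> [f [g fK gK]]; split; first by constructor; exact: f.
constructor; exact: (HB.pack_for {lrmorphism M -> L} g
  (GRing.isLinear.Build k M L *:%R g (can2_linear fK gK))
  (GRing.isMonoidMorphism.Build M L g (can2_monoid_morphism fK gK))).
Qed.

(** Field morphisms are injective, so embeddings both ways give equal finite dimensions, and [f] is
    onto. *)
Lemma embeds_isom L M : embeds L M -> embeds M L -> ext_isom L M.
Proof.
have inj0 L1 L2 (f : {lrmorphism L1 -> L2}) : lker (linfun f) == 0%VS.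
  by apply/lker0P => x y; rewrite !lfunE; exact: fmorph_inj.
have dimf L1 L2 (f : {lrmorphism L1 -> L2}) : \dim (limg (linfun f)) = \dim {:L1}.
  by rewrite limg_dim_eq // (eqP (inj0 _ _ f)) capv0.
move=> [f] [g]; exists f; pose F := linfun f.
have FT : limg F = fullv.
  apply/eqP; rewrite eqEdim subvf /F dimf -(dimf _ _ g); exact: dimvS (subvf _).
exists (F^-1)%VF => x.
  by rewrite -(lfunE f) lker0_lfunK ?inj0.
by rewrite -(lfunE f) limg_lfunVK // FT memvf.
Qed.

Lemma basis1z L (z : L) : (forall c : k, z != in_alg L c) -> (\dim {:L} <= 2)%N ->
  basis_of {:L} [tuple 1; z].
Proof.
move=> zP d; rewrite basisEfree subvf d andbT /= free_cons seq1_free span_seq1.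
have z0 : z != 0 by have := zP 0; rewrite rmorph0.
rewrite z0 !andbT; apply/negP => /vlineP[c E].
have c0 : c != 0 by apply: contraTneq (oner_neq0 L) => c0; rewrite E c0 scale0r eqxx.
by have /eqP := zP c^-1; rewrite in_algE E scalerA mulVf // scale1r.
Qed.

Lemma decomp1z L (z : L) : basis_of {:L} [tuple 1; z] ->
  forall y, exists m n, y = in_alg L m + in_alg L n * z.
Proof.
move=> B y; exists (coord [tuple 1; z] 0 y), (coord [tuple 1; z] (lift 0 0) y).
rewrite mulr_algl {1}(coord_basis B (memvf y)) !big_ord_recl big_ord0 addr0 /=.
by [].
Qed.

Lemma coord1z L (z : L) : basis_of {:L} [tuple 1; z] -> forall m n,
  coord [tuple 1; z] 0 (in_alg L m + in_alg L n * z) = m /\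
  coord [tuple 1; z] (lift 0 0) (in_alg L m + in_alg L n * z) = n.
Proof.
move=> B m n; have fr := basis_free B.
have c00 : coord [tuple 1; z] 0 1 = 1 := coord_free 0 0 fr.
have c01 : coord [tuple 1; z] (lift 0 0) 1 = 0 := coord_free 0 (lift 0 0) fr.
have c10 : coord [tuple 1; z] 0 z = 0 := coord_free (lift 0 0) 0 fr.
have c11 : coord [tuple 1; z] (lift 0 0) z = 1 := coord_free (lift 0 0) (lift 0 0) fr.
rewrite mulr_algl in_algE !linearD !linearZ /= c00 c01 c10 c11.
by rewrite !mulr0 !mulr1 addr0 add0r.
Qed.

Lemma free1z L (z : L) m n : basis_of {:L} [tuple 1; z] ->
  in_alg L m + in_alg L n * z = 0 -> m = 0 /\ n = 0.
Proof.
by move=> B E; have [] := coord1z B m n; rewrite E !linear0.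
Qed.

(** The map sends [z] to the root [w]; it is multiplicative because [z] and [w] satisfy the same
    quadratic relation. *)
Lemma quad_embeds L M (z : L) a b : basis_of {:L} [tuple 1; z] ->
  z ^+ 2 - in_alg L a * z + in_alg L b = 0 -> quad_root M a b -> embeds L M.
Proof.
move=> B zE [w wE].
pose f (y : L) : M := in_alg M (coord [tuple 1; z] 0 y) +
  in_alg M (coord [tuple 1; z] (lift 0 0) y) * w.
have fE m n : f (in_alg L m + in_alg L n * z) = in_alg M m + in_alg M n * w.
  by rewrite /f; have [-> ->] := coord1z B m n.
have f_lin : linear f.
  move=> c y y'; rewrite -[c *: f y]mulr_algl -in_algE /f.
  have cl i : coord [tuple 1; z] i (c *: y + y') =
      c * coord [tuple 1; z] i y + coord [tuple 1; z] i y' by rewrite linearP.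
  by rewrite !cl; ring.
have f_mul : monoid_morphism f.
  split.
    have -> : 1 = in_alg L 1 + in_alg L 0 * z by rewrite rmorph1 rmorph0 mul0r addr0.
    by rewrite fE rmorph1 rmorph0 mul0r addr0.
  move=> y y'; have [m [n ->]] := decomp1z B y; have [m' [n' ->]] := decomp1z B y'.
  have z2 : z ^+ 2 = in_alg L a * z - in_alg L b by rewrite -[RHS]addr0 -zE; ring.
  have w2 : w ^+ 2 = in_alg M a * w - in_alg M b by rewrite -[RHS]addr0 -wE; ring.
  rewrite !fE.
  have -> : (in_alg L m + in_alg L n * z) * (in_alg L m' + in_alg L n' * z) =
     in_alg L (m * m' - n * n' * b) + in_alg L (m * n' + n * m' + n * n' * a) * z.
    transitivity (in_alg L (m * m') + in_alg L (m * n' + n * m') * z + in_alg L (n * n') * z ^+ 2).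
      by ring.
    by rewrite z2; ring.
  rewrite fE.
  transitivity (in_alg M (m * m') + in_alg M (m * n' + n * m') * w + in_alg M (n * n') * w ^+ 2).
    by rewrite w2; ring.
  by ring.
constructor; exact: (HB.pack_for {lrmorphism L -> M} f
  (GRing.isLinear.Build k L M *:%R f f_lin) (GRing.isMonoidMorphism.Build L M f f_mul)).
Qed.

Lemma dim1_embeds L M : \dim {:L} = 1%N -> embeds L M.
Proof.
move=> d1; have B : basis_of {:L} [tuple (1 : L)].
  by rewrite basisEfree subvf d1 /= seq1_free oner_neq0.
have c1 : coord [tuple (1 : L)] 0 1 = 1 := coord_free 0 0 (basis_free B).
have yE (y : L) : y = in_alg L (coord [tuple (1 : L)] 0 y).
  by rewrite in_algE {1}(coord_basis B (memvf y)) big_ord_recl big_ord0 addr0.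
pose f (y : L) : M := in_alg M (coord [tuple (1 : L)] 0 y).
have fE m : f (in_alg L m) = in_alg M m by rewrite /f in_algE linearZ /= c1 mulr1.
have f_lin : linear f.
  by move=> c y y'; rewrite /f linearP rmorphD rmorphM /= mulr_algl.
have f_mul : monoid_morphism f.
  split; first by rewrite -[1](rmorph1 (in_alg L)) fE rmorph1.
  by move=> y y'; rewrite (yE y) (yE y') -rmorphM !fE rmorphM.
constructor; exact: (HB.pack_for {lrmorphism L -> M} f
  (GRing.isLinear.Build k L M *:%R f f_lin) (GRing.isMonoidMorphism.Build L M f f_mul)).
Qed.
End QuadraticExtensions.

(** * Extensions of degree at most 2 presented by quadratic polynomials *)

Section Presentations.
Variable k : fieldType.
Implicit Types (L M : fieldExtType k) (a b m n : k).

(** The universal property of the smallest field where [T^2 - a T + b] has a root. It covers at once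
    degree 2 and the split case, where [L] has degree 1 although the algebra has rank 2. *)
Definition presents L a b : Prop :=
  [/\ separable 1%VS {:L}%VS, (\dim {:L} <= 2)%N, a ^+ 2 - 4 * b != 0 &
      forall M, embeds L M <-> quad_root M a b].

Lemma quad_root_base a b :
  quad_root k^o a b <-> exists r : k, r ^+ 2 - a * r + b = 0.
Proof.
have E (r : k) : (r : k^o) ^+ 2 - in_alg k^o a * r + in_alg k^o b = r ^+ 2 - a * r + b.
  by rewrite !in_algE /GRing.scale /= !mulr1.
by split=> -[r rE]; exists r; rewrite -[RHS]rE E.
Qed.

Lemma dim1_separable L : \dim {:L} = 1%N -> separable 1%VS {:L}%VS.
Proof.
move=> d1; have -> : fullv = 1%VS :> {vspace L}.
  by apply/esym/eqP; rewrite eqEdim subvf dimv1 d1.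
exact: (separable_refl (1%AS : {subfield L})).
Qed.

Lemma presents_dim1 L a b : \dim {:L} = 1%N -> a ^+ 2 - 4 * b != 0 ->
  (exists r : k, r ^+ 2 - a * r + b = 0) -> presents L a b.
Proof.
move=> d1 disc rt; split; rewrite ?d1 //; first exact: dim1_separable.
move=> M; split=> [_|_]; last exact: dim1_embeds.
have : quad_root k^o a b by apply/quad_root_base.
apply: embeds_quad_root; apply: dim1_embeds; rewrite dimvf; exact: erefl.
Qed.

Lemma exists_presented a b : a ^+ 2 - 4 * b != 0 -> exists L, presents L a b.
Proof.
move=> disc.
have [rt|nrt] := pselect (exists r : k, r ^+ 2 - a * r + b = 0).
  exists k^o; apply: presents_dim1 => //; rewrite dimvf; exact: erefl.
pose p : {poly k} := 'X^2 - a *: 'X + b%:P.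
have sp : size p = 3 := size_quad a b.
have pE (r : k) : p.[r] = r ^+ 2 - a * r + b by rewrite /p !hornerE.
have irr : irreducible_poly p.
  apply: cubic_irreducible => [|r]; first by rewrite sp.
  by apply/negP => /rootP; rewrite pE => E; apply: nrt; exists r.
have [L dL [z rz zL]] := irredp_FAdjoin irr; rewrite sp /= in dL.
have zE : z ^+ 2 - in_alg L a * z + in_alg L b = 0.
  move: rz => /rootP; rewrite /p !rmorphD rmorphN /= map_polyZ map_polyX map_polyC map_polyXn.
  by rewrite !hornerE.
have B : basis_of {:L} [tuple 1; z].
  apply: basis1z; last by rewrite dL.
  move=> c; apply/eqP => cE; apply: nrt; exists c; apply: (fmorph_inj (in_alg L)).
  by rewrite rmorph0 -[RHS]zE cE; ring.
exists L; split => //; last 1 first.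
- move=> M; split; last exact: quad_embeds zE.
  by move=> /embeds_quad_root; apply; exists z.
- rewrite -zL -adjoin_separable_eq; apply/separable_elementP.
  exists (map_poly (in_alg L) p); split => //.
    by apply/polyOverP => i; rewrite coef_map; apply: rpredZ; exact: mem1v.
  rewrite unlock deriv_map coprimep_map.
  apply/Bezout_coprimepP; exists (- 4%:P, p^`()) => /=.
  have -> : - 4%:P * p + p^`() * p^`() = (a ^+ 2 - 4 * b)%:P.
    rewrite /p derivD derivB derivC derivZ derivX derivXn /= -!mul_polyC.
    ring.
  by rewrite polyC_eqp1.
- by rewrite dL.
Qed.

Lemma exists_presentation L : separable 1%VS {:L}%VS -> (\dim {:L} <= 2)%N ->
  exists a b, presents L a b.
Proof.
move=> sep d2.
have [d1|d1] := eqVneq (\dim {:L}) 1%N.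
  (* The polynomial [T^2 - T] is split with discriminant 1 over any field. *)
  exists 1, 0; apply: presents_dim1 => //; first by rewrite expr1n mulr0 subr0 oner_neq0.
  by exists 0; ring.
have [z _ z1] : exists2 z, z \in {:L}%VS & z \notin 1%VS.
  apply/subvPn; apply: contra d1 => /dimvS; rewrite dimv1 => d.
  by rewrite eqn_leq d; have := dimvS (subvf (1%VS : {vspace L})); rewrite dimv1.
have zc (c : k) : z != in_alg L c.
  by apply: contraNneq z1 => ->; apply: rpredZ; exact: mem1v.
have B := basis1z zc d2.
have [m [n z2]] := decomp1z B (z ^+ 2).
have zE : z ^+ 2 - in_alg L n * z + in_alg L (- m) = 0 by rewrite z2; ring.
exists n, (- m); split => //; last first.
  move=> M; split; last exact: quad_embeds zE.
  by move=> /embeds_quad_root; apply; exists z.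
apply/negP => /eqP disc.
(* A zero discriminant means [(2 z - n)^2 = 0]. If 2 is invertible, [z] is in the base field;
   otherwise [n = 0], so [z^2] is in the base field, and separability puts [z] in the field
   generated by [z^2]. *)
have zn : in_alg L 2 * z = in_alg L n.
  apply/eqP; rewrite -subr_eq0 -sqrf_eq0; apply/eqP.
  transitivity (in_alg L (n ^+ 2 - 4 * - m)); last by rewrite disc rmorph0.
  transitivity (4 * z ^+ 2 - 4 * in_alg L n * z + in_alg L n ^+ 2); first by ring.
  by rewrite z2; ring.
have [c2|c2] := eqVneq (2 : k) 0; last first.
  have /eqP := zc (n / 2); apply; apply: (mulfI (x := in_alg L 2)).
    by rewrite fmorph_eq0.
  by rewrite zn -rmorphM mulrCA divff ?mulr1.
have ch : 2 \in [pchar L].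
  by rewrite inE /= -(rmorph_nat (in_alg L)) c2 rmorph0.
have n0 : in_alg L n = 0 by rewrite -zn c2 rmorph0 mul0r.
have /separableP/(_ z (memvf z)) := sep.
rewrite (pcharf_p_separable _ _ 0 ch) expn1 z2 n0 mul0r addr0 => zin.
case/negP: z1; apply: (subvP _ _ zin).
apply/FadjoinP; split => //; apply: rpredZ; exact: mem1v.
Qed.

(** An affine substitution [m + n T] must carry one polynomial to the other. In the split case it
    matches the roots; otherwise it expresses a root [w] of the second polynomial in the basis
    [(1, z)] of [L]. *)
Lemma presents_orbit L L' a b a' b' : presents L a b -> presents L' a' b' ->
  ext_isom L L' -> GL_orbit (nf a b) (nf a' b').
Proof.
move=> [_ d2 disc H] [_ _ disc' H'] /ext_isom_embeds[LL' L'L].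
have key m n : n != 0 -> a' = 2 * m + n * a -> b' = m ^+ 2 + m * n * a + n ^+ 2 * b ->
    GL_orbit (nf a b) (nf a' b').
  by move=> n0 -> ->; exact: nf_subst.
have [rt|nrt] := pselect (exists r : k, r ^+ 2 - a * r + b = 0).
  have [r' rE'] : exists r : k, r ^+ 2 - a' * r + b' = 0.
    apply/quad_root_base/H'; apply: embeds_trans L'L _.
    exact/H/quad_root_base.
  have [r rE] := rt.
  have bE : b = a * r - r ^+ 2 by rewrite -[RHS]addr0 -rE; ring.
  have bE' : b' = a' * r' - r' ^+ 2 by rewrite -[RHS]addr0 -rE'; ring.
  have s0 : 2 * r - a != 0.
    apply: contraNneq disc => E; apply/eqP.
    by transitivity ((2 * r - a) ^+ 2); [rewrite bE; ring | rewrite E expr0n].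
  have s0' : 2 * r' - a' != 0.
    apply: contraNneq disc' => E; apply/eqP.
    by transitivity ((2 * r' - a') ^+ 2); [rewrite bE'; ring | rewrite E expr0n].
  (* The ratio of the differences of roots, since the second root is [a - r], respectively
     [a' - r']. *)
  pose n := (2 * r' - a') / (2 * r - a).
  have nE : n * (2 * r - a) = 2 * r' - a' by rewrite divfK.
  apply: (key (r' - n * r) n); first by rewrite mulf_neq0 // invr_eq0.
    rewrite (_ : a' = 2 * r' - n * (2 * r - a)); last by rewrite nE; ring.
    by ring.
  rewrite bE' bE (_ : a' = 2 * r' - n * (2 * r - a)); last by rewrite nE; ring.
  by ring.
have [z zE] : quad_root L a b by apply/H; exact: embeds_refl.
have [w wE] : quad_root L a' b' by apply/H'.
have B : basis_of {:L} [tuple 1; z].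
  apply: basis1z => // c; apply/eqP => cE; apply: nrt; exists c.
  by apply: (fmorph_inj (in_alg L)); rewrite rmorph0 -[RHS]zE cE; ring.
have [m [n wmn]] := decomp1z B w.
have z2 : z ^+ 2 = in_alg L a * z - in_alg L b by rewrite -[RHS]addr0 -zE; ring.
have [E1 E2] : m ^+ 2 - n ^+ 2 * b - a' * m + b' = 0 /\ 2 * m * n + n ^+ 2 * a - a' * n = 0.
  apply: (free1z B); rewrite -[RHS]wE wmn.
  transitivity (in_alg L (m ^+ 2) + in_alg L (2 * m * n) * z + in_alg L (n ^+ 2) * z ^+ 2
    - in_alg L a' * (in_alg L m + in_alg L n * z) + in_alg L b'); last by ring.
  by rewrite z2; ring.
(* Otherwise [m] is a root in [k] of the second polynomial, so [L'], and with it [L], embeds in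
   [k]. *)
have n0 : n != 0.
  apply/eqP => n0; apply: nrt; apply/quad_root_base/H; apply: embeds_trans LL' _.
  by apply/H'/quad_root_base; exists m; rewrite -[RHS]E1 n0; ring.
have aE : a' = 2 * m + n * a.
  by apply: (mulfI n0); apply/eqP; rewrite eq_sym -subr_eq0; apply/eqP; rewrite -[RHS]E2; ring.
apply: (key m n) => //.
have -> : b' = n ^+ 2 * b + a' * m - m ^+ 2 by rewrite -[RHS]addr0 -E1; ring.
by rewrite aE; ring.
Qed.

End Presentations.

(** * Orbits and extensions *)

Section Semistable.
Variables (k : fieldType) (K : closedFieldType) (iota : {rmorphism k -> K}).
Implicit Types (x : extpow k 3 6) (a b : k).

Lemma closed_quad_root (a b : K) : exists l : K, l ^+ 2 - a * l + b = 0.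
Proof.
pose p : {poly K} := 'X^2 - a *: 'X + b%:P.
have sp : size p = 3 := size_quad a b.
have /closed_rootP[l /rootP] : size p != 1 by rewrite sp.
by rewrite /p !hornerE => E; exists l.
Qed.

Lemma Vss_nf x : Vss iota x ->
  exists a b, a ^+ 2 - 4 * b != 0 /\ GL_orbit x (nf a b).
Proof.
move=> [_ ss].
have nn : ~ null3 (map_mx iota x) by move=> /null3_closure.
have [/(null3_map iota) //|[a [b orb]]] := null3_or_nf x.
exists a, b; split => //; apply/eqP => disc; apply: nn.
have [g gU gE] := orb.
have [l lE] := closed_quad_root (iota a) (iota b).
have bE : iota b = iota a * l - l ^+ 2 by rewrite -[RHS]addr0 -lE; ring.
have aE : iota a = 2 * l.
  apply/eqP; rewrite -subr_eq0 -sqrf_eq0; apply/eqP.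
  transitivity (iota (a ^+ 2 - 4 * b)); last by rewrite disc rmorph0.
  have -> : iota (a ^+ 2 - 4 * b) = iota a ^+ 2 - 4 * iota b by ring.
  by rewrite bE; ring.
apply: (@null3_extmx _ _ (map_mx iota g)); first by rewrite map_unitmx.
rewrite -extmx_map -gE nf_map.
have -> : iota b = l ^+ 2 by rewrite bE aE; ring.
by rewrite aE; exact: nf_double_null3.
Qed.

Lemma nf_Vss a b : a ^+ 2 - 4 * b != 0 -> Vss iota (nf a b).
Proof.
move=> disc.
suff ss : ~ zariski_closure (SL_orbit (map_mx iota (nf a b))) 0.
  split=> //; apply/eqP => E; apply: ss => Z [_]; apply.
  (* The zero vector lies in its own orbit. *)
  by exists 1%:M; [exact: det1 | rewrite E mulmx0].
have [l lE] := closed_quad_root (iota a) (iota b).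
have bE : iota b = l * (iota a - l) by rewrite -[RHS]addr0 -lE; ring.
have ls : l != iota a - l.
  apply: contraNneq disc => E; rewrite -(fmorph_eq0 iota); apply/eqP.
  have aE : iota a = 2 * l by rewrite mulr_natl mulr2n {1}E subrK.
  have -> : iota (a ^+ 2 - 4 * b) = iota a ^+ 2 - 4 * iota b by ring.
  by rewrite bE aE; ring.
have [A [B [hU E]]] := nf_split ls; rewrite -bE in E.
have aE : l + (iota a - l) = iota a by ring.
rewrite aE in E; rewrite nf_map E; exact: wedge_sum_semistable.
Qed.

Lemma splits_quad_root x a b (M : fieldExtType k) : GL_orbit x (nf a b) ->
  splits (map_mx (in_alg M) x) <-> quad_root M a b.
Proof.
move=> [g gU gE].
rewrite (@splits_extmx _ _ (map_mx (in_alg M) g)) ?map_unitmx //.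
by rewrite -extmx_map -gE nf_map; exact: splits_nf.
Qed.

Variable orb : extpow k 3 6 -> set (extpow k 3 6).
Hypothesis orb_GL : forall x y, GL_orbit x y -> orb x = orb y.
Hypothesis orb_splits : forall x y, orb x = orb y -> forall M : fieldExtType k,
  splits (map_mx (in_alg M) x) <-> splits (map_mx (in_alg M) y).

(** The parameter [orb] serves both groups: it need only be constant on [GL_orbit] and preserve
    [splits] over every extension. Being existential, the relation requires no choice of
    representative or presentation; [orbit_classE] shows independence of both. *)
Definition orbit_class (O : set (extpow k 3 6)) (N : fieldExtType k) : Prop :=
  exists x L a b,
    [/\ O = orb x, GL_orbit x (nf a b), presents L a b & ext_isom L N].

(** Two extensions presented from one orbit embed in the same fields [M]; taking [M] to be each of
    them gives embeddings both ways. *)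
Lemma orbit_classE x (L : fieldExtType k) a b : GL_orbit x (nf a b) -> presents L a b ->
  orbit_class (orb x) = ext_isom L.
Proof.
move=> xab Lab; apply/funext => N; apply/propext; split; last first.
  by move=> LN; exists x, L, a, b.
move=> [x' [L' [a' [b' [E x'ab' L'ab' L'N]]]]].
have same M : embeds L M <-> embeds L' M.
  have [_ _ _ H] := Lab; have [_ _ _ H'] := L'ab'.
  rewrite H H' -(splits_quad_root M xab) -(splits_quad_root M x'ab').
  exact: orb_splits.
have LL' : embeds L L' by apply/same; exact: embeds_refl.
have L'L : embeds L' L by apply/same; exact: embeds_refl.
have [eL'N eNL'] := ext_isom_embeds L'N.
by apply: embeds_isom; [exact: embeds_trans LL' _|exact: embeds_trans L'L].
Qed.

Lemma orbit_class_bij : bij_on [set orb x | x in Vss iota]%classic (@Ex2 k) orbit_class.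
Proof.
split.
- move=> _ [x /Vss_nf[a [b [disc xab]]] <-].
  have [L Lab] := exists_presented disc; exists L; have [sep d2 _ _] := Lab.
  by split => //; exact: orbit_classE xab Lab.
- move=> _ _ [x /Vss_nf[a [b [disc xab]]] <-] [x' /Vss_nf[a' [b' [disc' x'ab']]] <-].
  have [L Lab] := exists_presented disc; have [L' Lab'] := exists_presented disc'.
  rewrite (orbit_classE xab Lab) (orbit_classE x'ab' Lab') => E.
  have LL' : ext_isom L L' by rewrite E; exists idfun; exists idfun.
  rewrite (orb_GL xab) (orb_GL x'ab'); apply: orb_GL.
  exact: presents_orbit Lab Lab' LL'.
- move=> _ [L [sep d2 ->]].
  have [a [b Lab]] := exists_presentation sep d2; have [_ _ disc _] := Lab.
  exists (orb (nf a b)); first by exists (nf a b) => //; exact: nf_Vss.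
  apply: orbit_classE Lab; exists 1%:M; [exact: unitmx1 | by rewrite extmx1].
Qed.

End Semistable.

Section Orbits.
Variable k : fieldType.
Implicit Types x y : extpow k 3 6.

Lemma GL_orbit_eq x y : GL_orbit x y -> GL_orbit x = GL_orbit y.
Proof.
move=> [g gU ->]; apply/seteqP; split=> z [h hU ->].
  exists (h *m invmx g); first by rewrite unitmx_mul hU unitmx_inv.
  by rewrite -extmxM mulmxKV.
by exists (h *m g); rewrite ?unitmx_mul ?hU // extmxM.
Qed.

Lemma GL1GL_orbit_eq x y : GL_orbit x y -> GL1GL_orbit x = GL1GL_orbit y.
Proof.
move=> [g gU ->]; apply/seteqP; split=> z [t [h [t0 hU ->]]].
  exists t, (h *m invmx g); split; rewrite ?unitmx_mul ?hU ?unitmx_inv //.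
  by rewrite -extmxM mulmxKV.
by exists t, (h *m g); split; rewrite ?unitmx_mul ?hU // extmxM.
Qed.

Lemma GL1GL_orbit_splits x y : GL1GL_orbit x y -> forall M : fieldExtType k,
  splits (map_mx (in_alg M) x) <-> splits (map_mx (in_alg M) y).
Proof.
move=> [t [g [t0 gU ->]]] M; rewrite map_mxZ extmx_map -splitsZ ?fmorph_eq0 //.
by apply: splits_extmx; rewrite map_unitmx.
Qed.

Lemma GL_orbit_GL1GL x y : GL_orbit x y -> GL1GL_orbit x y.
Proof. by move=> [g gU ->]; exists 1, g; rewrite oner_neq0 scale1r. Qed.

Lemma GL_orbit_refl x : GL_orbit x x.
Proof. by exists 1%:M; [exact: unitmx1 | rewrite extmx1]. Qed.

End Orbits.

Local Open Scope classical_set_scope.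

Theorem theorem4p17 (k : fieldType) (K : closedFieldType)
    (iota : {rmorphism k -> K}) (HK : is_algebraic_closure iota) :
  (exists f : set (extpow k 3 6) -> (fieldExtType k -> Prop),
     bij_on [set GL_orbit x | x in Vss iota] (@Ex2 k) f) /\
  (exists f : set (extpow k 3 6) -> (fieldExtType k -> Prop),
     bij_on [set GL1GL_orbit x | x in Vss iota] (@Ex2 k) f).
Proof.
split.
  exists (orbit_class (@GL_orbit k)).
  apply: orbit_class_bij => x y; first exact: GL_orbit_eq.
  move=> E; apply: GL1GL_orbit_splits; apply: GL_orbit_GL1GL.
  by rewrite E; exact: GL_orbit_refl.
exists (orbit_class (@GL1GL_orbit k)).
apply: orbit_class_bij => x y; first exact: GL1GL_orbit_eq.
move=> E; apply: GL1GL_orbit_splits.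
by rewrite E; exact: GL_orbit_GL1GL (GL_orbit_refl y).
Qed.
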